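(* Let $m,n>1$ be integers with $mn$ even. A cyclic hamiltonian $2$-factorization of $K_{m\times n}$ exists if and only if all of the following three conditions are satisfied: (a) $n$ is even; (b) if $n\equiv 2\pmod 4$, then $m\equiv 1,2\pmod 4$; (c) if $n=2$, then $m$ is not of the form $p^\alpha$ with $p$ an odd prime and $\alpha\geq 1$ an integer.
   Context: $K_{m\times n}$ denotes the complete multipartite graph with $m$ parts, each of cardinality $n$. Its vertex set is always taken to be $\mathbb{Z}_{mn}$, and its parts are the cosets of the subgroup $m\mathbb{Z}_{mn}$ (the subgroup of index $m$); thus distinct $x,y\in\mathbb{Z}_{mn}$ are adjacent iff $x-y\notin m\mathbb{Z}_{mn}$. A $2$-factor of a graph is a set of cycles (subgraphs) whose vertex sets partition the vertex set of the graph. A $2$-factorization is a set $\mathcal{F}$ of $2$-factors such that every edge of the graph appears in exactly one member of $\mathcal{F}$. A hamiltonian $2$-factorization is one in which every $2$-factor is a single hamiltonian cycle (of length $mn$). A $2$-factorization $\mathcal{F}$ of $K_{m\times n}$ is cyclic if $F+g\in\mathcal{F}$ for every $F\in\mathcal{F}$ and every $g\in\mathbb{Z}_{mn}$, where $F+g$ is obtained by replacing each vertex $x$ by $x+g$. *)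

(* Defs.v *)
From mathcomp Require Import all_boot all_order all_algebra.

Set Implicit Arguments.
Unset Strict Implicit.
Unset Printing Implicit Defensive.

Import GRing.Theory.
Local Open Scope ring_scope.

(* A graph on V is given by its adjacency relation and an edge is an unordered
   pair {set V}. A cycle, having no isolated vertex, is represented as a
   subgraph by its edge set C : {set {set V}}, so that its vertex set is
   [cover C]. A set of cycles is F : {set {set {set V}}}, and its edge set is
   [cover F]. *)

Section Factorizations.

Variables (V : finType) (adj : rel V).

Definition edges : {set {set V}} :=
  [set [set x; y] | x in V, y in V & adj x y].

Definition cycle_edges (s : seq V) : {set {set V}} :=
  [set [set x; next s x] | x in s].

Definition is_cycle (C : {set {set V}}) : Prop :=
  exists s : seq V, [/\ (3 <= size s)%N, ucycle adj s & C = cycle_edges s].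

Definition is_hamiltonian_cycle (C : {set {set V}}) : Prop :=
  is_cycle C /\ cover C = [set: V].

Definition is_2factor (F : {set {set {set V}}}) : Prop :=
  (forall C, C \in F -> is_cycle C) /\
  (forall x : V, exists! C, C \in F /\ x \in cover C).

Definition is_2factorization (FF : {set {set {set {set V}}}}) : Prop :=
  (forall F, F \in FF -> is_2factor F) /\
  (forall e, e \in edges -> exists! F, F \in FF /\ e \in cover F).

Definition is_hamiltonian_2factorization
    (FF : {set {set {set {set V}}}}) : Prop :=
  is_2factorization FF /\
  (forall F, F \in FF -> exists2 C, is_hamiltonian_cycle C & F = [set C]).

End Factorizations.

Definition translate (V : finZmodType) (g : V) (F : {set {set {set V}}}) :
    {set {set {set V}}} :=
  [set [set [set x + g | x in e] | e : {set V} in C]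
     | C : {set {set V}} in F].

Definition is_cyclic (V : finZmodType) (FF : {set {set {set {set V}}}}) : Prop :=
  forall F (g : V), F \in FF -> translate g F \in FF.

(* 'Z_(m * n) is the ring of integers modulo m * n only when 1 < m * n. *)
Definition part_subgroup (m n : nat) : {set 'Z_(m * n)} :=
  [set m%:R * z | z : 'Z_(m * n)].

Definition multipartite_adj (m n : nat) : rel 'Z_(m * n) :=
  fun x y => x - y \notin part_subgroup m n.

(* Main.v *)
(** A cyclic factorization is a union of orbits of hamiltonian cycles under
    translation. A cycle whose orbit has [k] elements satisfies
    [c (i + k) = c i + g], where [g] generates the subgroup of index [k], and its
    steps [c i.+1 - c i] take [k] values, distinct up to sign. Hence a cyclic
    factorization amounts to a list of "base cycles" (lists of [k] steps whose
    partial sums are distinct mod [k] and whose total is [k] times a unit mod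
    [N / k]) that together use each element outside [m Z_N] once up to sign.

    Necessity. Each cycle has two edges at [0], so [n (m - 1)] is even. Since [g]
    and [k] have the same parity, each base cycle has an even number of even
    steps; so the number of even elements outside [m Z_N] is divisible by 4,
    which gives (b). If [n = 2] and [m = p ^ a] there are [m - 1] cycles, so the
    cycle through the edge [{0, 2 p ^ (a - 1)}] is fixed by a nonzero translation
    smaller than [m], hence by [2 p ^ (a - 1)] itself, and then it cannot be
    hamiltonian.

    Sufficiency. Multiples of the zigzag [0, 1, -1, 2, -2, ...] mod an odd [M] use
    every class [±r] twice and the closing class once more. Choosing even
    representatives for the zigzag and an odd one for its closing step uses up the
    even differences; the remaining odd differences are grouped in pairs [a, a + 2],
    each of which is a base cycle with [k = 2]. For [n = 2] and [m = a b] with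
    coprime [a], [b], the multiples of [a] are used by one zigzag mod [b]. When
    4 divides [m] and [n], one zigzag on the even residues mod [m] is linked with
    one on the odd residues. *)

Require Import Defs.
From mathcomp Require Import all_boot all_order all_algebra.
From mathcomp Require Import zify ring.

Set Implicit Arguments.
Unset Strict Implicit.
Unset Printing Implicit Defensive.

Import GRing.Theory.

(** * Enumerations of hamiltonian cycles *)

Lemma eqn_modS N i j : (i.+1 == j.+1 %[mod N]) = (i == j %[mod N]).
Proof. by rewrite -addn1 -[j.+1]addn1 eqn_modDr. Qed.

Section Enumerations.

Variable V : finType.
Implicit Types (c : nat -> V) (C : {set {set V}}).

(** Indices range over all of [nat] and count mod [#|V|], so that rotations and periods of a cycle
    become plain additions. *)
Definition enumerates c C : Prop :=
  (forall i j, c i = c j <-> i = j %[mod #|V|]) /\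
  (forall e, e \in C <-> exists i, e = [set c i; c i.+1]).

Lemma set2_eq (x y z t : V) :
  [set x; y] = [set z; t] -> (x = z /\ y = t) \/ (x = t /\ y = z).
Proof.
move=> E.
have: x \in [set z; t] by rewrite -E set21.
have: y \in [set z; t] by rewrite -E set22.
have: z \in [set x; y] by rewrite E set21.
have: t \in [set x; y] by rewrite E set22.
rewrite !inE => /orP[]/eqP H1 /orP[]/eqP H2 /orP[]/eqP H3 /orP[]/eqP H4.
all: try (by left; split); try (by right; split).
all: by left; split; congruence.
Qed.

Lemma enum_surj c C x : enumerates c C -> exists i, x = c i.
Proof.
case=> ci _; have inj : injective (fun i : 'I_#|V| => c i).
  by move=> i j /ci; rewrite !modn_small // => /val_inj.
have [f _ fK] : bijective (fun i : 'I_#|V| => c i).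
  by apply: inj_card_bij; rewrite ?card_ord.
by exists (f x); rewrite fK.
Qed.

Lemma next_mkseq (T : eqType) (c : nat -> T) N i : (0 < N)%N ->
  (forall i j, c i = c j <-> i = j %[mod N]) ->
  next (mkseq c N) (c i) = c i.+1.
Proof.
move=> N0 ci.
have uq : uniq (mkseq c N).
  apply/mkseq_uniqP => j k; rewrite !inE => jN kN /ci.
  by rewrite !modn_small.
have -> : c i = nth (c 0%N) (mkseq c N) (i %% N).
  by rewrite nth_mkseq ?ltn_mod //; apply/ci; rewrite modn_mod.
rewrite next_nth mem_nth ?size_mkseq ?ltn_mod // index_uniq ?size_mkseq ?ltn_mod //.
case: N N0 ci uq => // N _ ci uq.
rewrite /mkseq /=.
have [lt|ge] := ltnP (i %% N.+1) N.
  rewrite (nth_map 0%N) ?size_iota // nth_iota //.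
  by apply/ci; rewrite add1n -addn1 modnDml addn1.
rewrite nth_default ?size_map ?size_iota //; apply/ci.
have -> : i.+1 = (i %/ N.+1 * N.+1 + (i %% N.+1).+1)%N by rewrite addnS -divn_eq.
have -> : i %% N.+1 = N by apply/eqP; rewrite eqn_leq ge -ltnS ltn_pmod.
by rewrite modnMDl modnn mod0n.
Qed.

Lemma hamiltonian_enum (adj : rel V) C : is_hamiltonian_cycle adj C ->
  exists2 c, enumerates c C & forall i, adj (c i) (c i.+1).
Proof.
case=> -[s [s3 /andP[cyc us] ->]] cov.
have sall x : x \in s.
  have: x \in cover (cycle_edges s) by rewrite cov inE.
  case/bigcupP=> e /imsetP[y ys ->]; rewrite !inE => /orP[]/eqP-> //.
  by rewrite mem_next.
have sz : size s = #|V|.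
  by rewrite -(card_uniqP us); apply: eq_card => x; rewrite sall.
have s0 : (0 < size s)%N by apply: leq_trans s3.
have [x0 _] : {x | x \in s} by case: s s0 {cyc us cov sall sz s3} => // x s _; exists x; rewrite mem_head.
pose c i := nth x0 s (i %% size s).
have ci i j : c i = c j <-> i = j %[mod size s].
  split=> [/eqP|]; last by rewrite /c => ->.
  by rewrite /c nth_uniq ?ltn_mod // => /eqP.
have sE : s = mkseq c (size s).
  apply: (@eq_from_nth _ x0) => [|i lt]; rewrite ?size_mkseq //.
  by rewrite nth_mkseq // /c modn_small.
have nx i : next s (c i) = c i.+1 by rewrite {1}sE next_mkseq.
exists c; last by move=> i; rewrite -nx (next_cycle cyc).
split=> [i j|e]; first by rewrite -sz.
split=> [/imsetP[x xs ->]|[i ->]].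
  exists (index x s); rewrite -nx.
  by rewrite /c modn_small ?index_mem // nth_index.
by apply/imsetP; exists (c i); rewrite ?sall ?nx.
Qed.

Lemma enum_hamiltonian (adj : rel V) c C : (2 < #|V|)%N -> enumerates c C ->
  (forall i, adj (c i) (c i.+1)) -> is_hamiltonian_cycle adj C.
Proof.
move=> V3 cC cadj; have [ci CE] := cC; have V0 : (0 < #|V|)%N by lia.
have nx := next_mkseq _ V0 ci.
have uq : uniq (mkseq c #|V|).
  apply/mkseq_uniqP => j k; rewrite !inE => jN kN /ci.
  by rewrite !modn_small.
have ms i : c i \in mkseq c #|V|.
  have -> : c i = c (i %% #|V|) by apply/ci; rewrite modn_mod.
  by rewrite map_f // mem_iota /= ltn_mod.
split.
  exists (mkseq c #|V|); split; rewrite ?size_mkseq //.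
    rewrite /ucycle uq andbT; apply: cycle_from_next => // x.
    by case/mapP=> i _ ->; rewrite nx.
  apply/setP => e; apply/idP/imsetP => [/CE[i ->]|[x /mapP[i _ ->] ->]].
    by exists (c i); rewrite ?nx.
  by apply/CE; exists i; rewrite nx.
apply/setP => x; rewrite inE; apply/bigcupP.
have [i ->] := enum_surj x cC.
by exists [set c i; c i.+1]; [apply/CE; exists i | rewrite set21].
Qed.

Lemma enum_neighbor c C i y : (2 < #|V|)%N -> enumerates c C ->
  [set c i.+1; y] \in C -> y = c i \/ y = c i.+2.
Proof.
move=> V3 [ci CE] /CE[j] /set2_eq[[/ci E ->]|[/ci E ->]].
  by right; apply/ci/eqP; rewrite eqn_modS; apply/eqP.
by left; apply/ci/eqP; rewrite eq_sym -eqn_modS; apply/eqP.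
Qed.

(** A vertex has only two neighbours on the cycle, and turning back would identify indices that
    differ by 2, less than [#|V|]. So agreement on one directed edge propagates forward. *)
Lemma enum_rotation c c' C i j : (2 < #|V|)%N -> enumerates c C ->
  enumerates c' C -> c i = c' j -> c i.+1 = c' j.+1 ->
  forall l, c (i + l)%N = c' (j + l)%N.
Proof.
move=> V3 cC cC' e0 e1 l.
suff [] : c (i + l)%N = c' (j + l)%N /\ c (i + l).+1 = c' (j + l).+1 by [].
elim: l => [|l [IH0 IH1]]; first by rewrite !addn0.
rewrite !addnS; split=> //.
have: [set c' (j + l).+1; c (i + l).+2] \in C.
  by rewrite -IH1; case: cC => _ ->; exists (i + l).+1.
case/(enum_neighbor V3 cC') => //; rewrite -IH0; case: cC => ci _ /ci E.
have : 2 = 0 %[mod #|V|] by apply/eqP; rewrite -(eqn_modDl (i + l)) addn0 addn2; apply/eqP.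
by rewrite mod0n modn_small.
Qed.

(* Steps of [#|V| - 1] walk the cycle backwards. *)
Lemma enum_reverse c C j : (2 < #|V|)%N -> enumerates c C ->
  enumerates (fun l => c (j + #|V|.-1 * l)%N) C.
Proof.
move=> V3 [ci CE]; set N := #|V| in V3 ci *.
have cop : coprime N N.-1 by rewrite coprime_sym; apply: coprimePn; lia.
have step i : c (j + N.-1 * i)%N = c (j + N.-1 * i.+1).+1.
  apply/ci; rewrite mulnS; have -> : (j + (N.-1 + N.-1 * i)).+1 = (N + (j + N.-1 * i))%N by lia.
  by rewrite modnDl.
split=> [i k|e].
  rewrite ci; split=> [/eqP|/eqP E]; last by apply/eqP; rewrite eqn_modDl -modnMmr (eqP E) modnMmr.
  rewrite eqn_modDl.
  wlog le : i k / (k <= i)%N.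
    by move=> W; case/orP: (leq_total k i) => /W // H; rewrite eq_sym => /H/esym.
  by rewrite !eqn_mod_dvd ?leq_mul // -mulnBr Gauss_dvdr // -eqn_mod_dvd // => /eqP.
rewrite CE; split=> -[i ->].
  (* As [N.-1] is [-1] mod [N], the map [l -> j - l] on indices is its own inverse; this gives the
     preimage of [i + k]. *)
  have E k : (j + N.-1 * (N.-1 * (i + k) + j))%N = (i + k) %[mod N].
    have -> : (j + N.-1 * (N.-1 * (i + k) + j) = (N.-2 * (i + k) + j) * N + (i + k))%N by nia.
    by rewrite modnMDl.
  exists (N.-1 * i.+1 + j)%N; rewrite setUC; congr [set _; _].
    by apply/ci; rewrite -[i.+1]addn1 E.
  apply/ci; have -> : (j + N.-1 * (N.-1 * i.+1 + j).+1 = (N.-2 * i.+1 + j + 1) * N + i)%N by nia.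
  by rewrite modnMDl.
exists (j + N.-1 * i.+1)%N; rewrite setUC; congr [set _; _]; exact: step.
Qed.

Lemma enum_edges c : (forall i j, c i = c j <-> i = j %[mod #|V|]) ->
  enumerates c [set [set c i; c i.+1] | i : 'I_#|V|].
Proof.
move=> ci; split=> // e; split=> [/imsetP[i _ ->]|[i ->]]; first by exists i.
have V0 : 0 < #|V| by apply/card_gt0P; exists (c 0).
apply/imsetP; exists (Ordinal (ltn_pmod i V0)) => //=.
congr [set _; _]; apply/ci; first by rewrite modn_mod.
by apply/eqP; rewrite eqn_modS modn_mod.
Qed.

Lemma enum_shift_edges c c' C C' i j : enumerates c C -> enumerates c' C' ->
  (forall l, c (i + l) = c' (j + l)) -> C = C'.
Proof.
move=> [ci CE] [ci' CE'] E.
have V0 : 0 < #|V| by apply/card_gt0P; exists (c 0).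
(* [#|V|.-1 * a] plays the role of [-a] among the indices. *)
have K a b : a + (b + #|V|.-1 * a) = b %[mod #|V|].
  have -> : a + (b + #|V|.-1 * a) = a * #|V| + b by nia.
  by rewrite modnMDl.
apply/setP => e; apply/idP/idP => [/CE|/CE'] [a ->].
  apply/CE'; exists (j + (a + #|V|.-1 * i)); rewrite -addnS -!E.
  by congr [set _; _]; apply/ci => //; apply/eqP; rewrite addnS eqn_modS; apply/eqP/esym/K.
apply/CE; exists (i + (a + #|V|.-1 * j)); rewrite -addnS !E.
by congr [set _; _]; apply/ci' => //; apply/eqP; rewrite addnS eqn_modS; apply/eqP/esym/K.
Qed.

End Enumerations.

Local Open Scope ring_scope.

(** * Translates of cycles *)

Section Translations.

Variable V : finZmodType.
Implicit Types (c : nat -> V) (C : {set {set V}}) (g : V).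

Definition translate_cycle g C : {set {set V}} :=
  [set [set x + g | x in e] | e : {set V} in C].

Lemma translate_set2 g (x y : V) :
  [set z + g | z in [set x; y]] = [set x + g; y + g].
Proof. by rewrite imsetU1 imset_set1. Qed.

Lemma enum_translate c C g : enumerates c C ->
  enumerates (fun i => c i + g) (translate_cycle g C).
Proof.
case=> ci CE; split=> [i j|e].
  by rewrite -ci; split=> [/addIr|->].
split=> [/imsetP[e' /CE[i ->] ->]|[i ->]].
  by exists i; rewrite translate_set2.
rewrite -translate_set2; apply: imset_f; apply/CE; by exists i.
Qed.

Lemma translate_cycleD g h C :
  translate_cycle h (translate_cycle g C) = translate_cycle (g + h) C.
Proof.
rewrite /translate_cycle -imset_comp; apply: eq_imset => e /=.
by rewrite -imset_comp; apply: eq_imset => x /=; rewrite addrA.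
Qed.

Lemma translate_cycle0 C : translate_cycle 0 C = C.
Proof.
rewrite -[RHS]imset_id; apply: eq_imset => e /=.
by rewrite -[RHS]imset_id; apply: eq_imset => x /=; rewrite addr0.
Qed.

Lemma translate_set1 g C : translate g [set C] = [set translate_cycle g C].
Proof. exact: imset_set1. Qed.

End Translations.

Section Residues.

Variables (N : nat).
Hypothesis N1 : (1 < N)%N.

Lemma intr_Zp_eq0 (z : int) : (z%:~R == 0 :> 'Z_N) = (N %| z)%Z.
Proof.
have N0 : (N%:Z != 0) by lia.
rewrite {1}(divz_eq z N) rmorphD rmorphM /= -[in X in _ * X]pmulrn.
rewrite (_ : N%:R = 0 :> 'Z_N) ?mulr0 ?add0r; last exact: pchar_Zp.
have: (0 <= z %% N)%Z by rewrite modz_ge0.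
have: (z %% N < N)%Z by apply: ltz_pmod; lia.
rewrite (sameP dvdz_mod0P eqP); case: (z %% N)%Z => // r rN _.
by rewrite -pmulrn -val_eqE /= val_Zp_nat // modn_small.
Qed.

Lemma intr_Zp_eq (y z : int) : (y%:~R == z%:~R :> 'Z_N) = (N %| y - z)%Z.
Proof. by rewrite -intr_Zp_eq0 rmorphB subr_eq0. Qed.

Lemma card_Zp_ring : #|'Z_N| = N.
Proof. by rewrite card_ord Zp_cast. Qed.

End Residues.

(** * From base cycles to factorizations *)

(** Reading the entries mod [size s] gives the partial sums of the periodic repetition of [s], for
    every [j]. *)
Definition psum (s : seq int) (j : nat) : int := \sum_(i < j) s`_(i %% size s)%N.

(* [s] lists the steps of one period: repeated [N / size s] times, it closes up to
   a hamiltonian cycle fixed by the translation [psum s (size s)]. *)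
Definition base_cycle (N : nat) (s : seq int) : Prop :=
  [/\ (0 < size s)%N, (size s %| N)%N,
      forall i j, (i < j < size s)%N -> ~~ (size s %| psum s j - psum s i)%Z
    & exists2 u : int, psum s (size s) = (size s)%:Z * u
                     & coprimez u (N %/ size s)%N].

Section BaseCycles.

Variables (N : nat) (s : seq int).
Hypotheses (N0 : (0 < N)%N) (sb : base_cycle N s).

Let k := size s.

Lemma psumS j : psum s j.+1 = psum s j + s`_(j %% k)%N.
Proof. by rewrite /psum big_ord_recr. Qed.

Lemma psum_period q j : psum s (q * k + j)%N = psum s j + q%:Z * psum s k.
Proof.
have P1 i : psum s (k + i)%N = psum s i + psum s k.
  elim: i => [|i IH]; first by rewrite addn0 /psum big_ord0 add0r.
  by rewrite addnS !psumS IH modnDl; ring.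
elim: q => [|q IH]; first by rewrite mul0r addr0.
by rewrite mulSn -addnA P1 IH; lia.
Qed.

(** Mod [k] a partial sum determines its index mod [k]. For equal residues the sums differ by
    [k * u] times the difference of the quotients, and [u] is invertible mod [N %/ k]. *)
Lemma psum_inj i j : (N %| psum s i - psum s j)%Z <-> i = j %[mod N].
Proof.
case: sb => k0 kN dis [u su cu]; rewrite -/k in k0 kN dis su cu.
have NE : N = (N %/ k * k)%N by rewrite divnK.
set h := (N %/ k)%N in NE cu.
have h0 : (0 < h)%N by rewrite divn_gt0 // dvdn_leq.
have E a : psum s a = psum s (a %% k)%N + (a %/ k)%N%:Z * psum s k.
  by rewrite {1}(divn_eq a k) psum_period.
have per a b t : (a = t * N + b)%N -> (N %| psum s a - psum s b)%Z.
  move=> ->; rewrite {1}NE mulnA psum_period su NE; apply/dvdzP.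
  by exists (t%:Z * u); rewrite !PoszM; ring.
split; last first.
  move=> H; rewrite -[X in X - _](subrK (psum s (i %% N)%N)) -addrA rpredD //.
    by apply: (@per _ _ (i %/ N)%N); rewrite -divn_eq.
  rewrite H -opprB rpredN; apply: (@per _ _ (j %/ N)%N); by rewrite -divn_eq.
wlog le : i j / (i %% k <= j %% k)%N.
  move=> W; case/orP: (leq_total (i %% k) (j %% k)) => [/W//|/W{}W].
  by rewrite -opprB rpredN => /W.
move=> D.
have kD : (k %| psum s (j %% k)%N - psum s (i %% k)%N)%Z.
  have : (k %| psum s i - psum s j)%Z by apply: dvdz_trans D; rewrite NE PoszM dvdz_mull.
  rewrite (E i) (E j) su -opprB rpredN => H.
  rewrite -[X in (_ %| X)%Z](addrK (k%:Z * (u * ((j %/ k)%N%:Z - (i %/ k)%N%:Z)))) rpredB ?dvdz_mulr //.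
  by move: H; congr (_ %| _)%Z; ring.
have ij : (i %% k = j %% k)%N.
  apply/eqP; rewrite eqn_leq le leqNgt; apply/negP => lt.
  by have := dis (i %% k)%N (j %% k)%N; rewrite lt ltn_pmod // kD => /(_ isT).
have hD : (h %| (i %/ k)%N%:Z - (j %/ k)%N%:Z)%Z.
  move: D; rewrite (E i) (E j) ij su.
  have -> : psum s (j %% k)%N + (i %/ k)%N%:Z * (k%:Z * u) -
     (psum s (j %% k)%N + (j %/ k)%N%:Z * (k%:Z * u)) = u * ((i %/ k)%N%:Z - (j %/ k)%N%:Z) * k%:Z by ring.
  rewrite NE PoszM dvdz_mul2r; last by lia.
  by rewrite Gauss_dvdzr // coprimez_sym.
rewrite (divn_eq i k) (divn_eq j k) ij; apply/eqP; rewrite eqn_modDr NE.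
rewrite -!muln_modl eqn_pmul2r //.
by move: hD; rewrite -eqz_mod_dvd !modz_nat.
Qed.

End BaseCycles.

Lemma flatten_uniq_eq (T : eqType) (ss : seq (seq T)) s t x :
  uniq (flatten ss) -> s \in ss -> t \in ss -> x \in s -> x \in t -> s = t.
Proof.
elim: ss => //= r ss IH; rewrite cat_uniq => /and3P[_ /hasPn rss uss].
have out u : u \in ss -> x \in u -> x \notin r.
  by move=> uss' xu; apply: rss; apply/flattenP; exists u.
rewrite !inE => /orP[/eqP->|ss_s] /orP[/eqP->|ss_t] // xs xt.
- by rewrite (negPf (out t ss_t xt)) in xs.
- by rewrite (negPf (out s ss_s xs)) in xt.
exact: IH.
Qed.

Lemma flatten_uniq (T : eqType) (ss : seq (seq T)) s :
  uniq (flatten ss) -> s \in ss -> uniq s.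
Proof.
elim: ss => //= r ss IH; rewrite cat_uniq => /and3P[ur _ uss].
by rewrite inE => /orP[/eqP->|/IH]; last apply.
Qed.

Lemma map_uniq_inj (T U : eqType) (f : T -> U) s :
  uniq (map f s) -> {in s &, injective f}.
Proof.
move=> us x y xs ys E; rewrite -(nth_index x xs) -(nth_index x ys); congr nth.
apply/eqP; rewrite -(nth_uniq (f x) _ _ us) ?size_map ?index_mem //.
by rewrite !(nth_map x) ?index_mem // !nth_index // E.
Qed.

Lemma card_multiples N d : (1 < N)%N -> (d %| N)%N ->
  #|[set x : 'Z_N | (d %| x)%N]| = (N %/ d)%N.
Proof.
move=> N1 /dvdnP[h NE]; have [d0 h0] : (0 < d)%N /\ (0 < h)%N by nia.
rewrite NE mulnK //; rewrite -NE.
have -> : [set x : 'Z_N | (d %| x)%N] = [set (d * i)%:R | i : 'I_h].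
  apply/setP => x; rewrite inE; apply/idP/imsetP => [/dvdnP[q xq]|[i _ ->]].
    have xN : (x < N)%N by rewrite -[X in (_ < X)%N](Zp_cast N1).
    have qh : (q < h)%N by move: xN; rewrite xq NE ltn_pmul2r.
    by exists (Ordinal qh) => //; rewrite -[LHS]natr_Zp; congr _%:R; rewrite xq; apply: mulnC.
  by rewrite val_Zp_nat // /dvdn modn_dvdm ?NE ?dvdn_mull // modnMr.
rewrite card_imset ?card_ord // => i j /(congr1 val) /=.
have lt (a : 'I_h) : (d * a < N)%N by rewrite NE mulnC ltn_pmul2r.
rewrite !val_Zp_nat // !modn_small // => /eqP; rewrite eqn_pmul2l //.
by move=> /eqP/val_inj.
Qed.

(** * The part subgroup and the number of admissible differences *)

Section Multipartite.

Variables m n : nat.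
Hypotheses (m1 : (1 < m)%N) (n1 : (1 < n)%N).
Let N := (m * n)%N.
Let N1 : (1 < N)%N. Proof. by rewrite /N; nia. Qed.

Lemma part_intr (z : int) :
  (z%:~R \in part_subgroup m n) = (m %| z)%Z.
Proof.
apply/imsetP/idP => [[w _ /eqP]|/dvdzP[q ->]]; last first.
  by exists q%:~R; rewrite // rmorphM /= mulrC.
rewrite -[w]natr_Zp -natrM pmulrn intr_Zp_eq // => D.
rewrite -[z](subrK (m * w)%N%:Z) rpredD //; last by rewrite PoszM dvdz_mulr.
apply: dvdz_trans D; rewrite PoszM; exact: dvdz_mulr.
Qed.

Lemma part_val (x : 'Z_(m * n)) : (x \in part_subgroup m n) = (m %| x)%N.
Proof. by rewrite -{1}[x]natr_Zp pmulrn part_intr. Qed.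

Lemma card_part : #|part_subgroup m n| = n.
Proof.
rewrite -[RHS](mulKn n (ltnW m1)) -(card_multiples N1) ?dvdn_mulr //.
by apply: eq_card => x; rewrite part_val inE.
Qed.

Lemma card_nonpart : #|[set x | x \notin part_subgroup m n]| = (n * m.-1)%N.
Proof.
have -> : [set x | x \notin part_subgroup m n] = ~: part_subgroup m n.
  by apply/setP => x; rewrite !inE.
by have := cardsC (part_subgroup m n); rewrite card_part card_Zp_ring //; nia.
Qed.

Lemma multipartite_adjP (x y : 'Z_(m * n)) :
  multipartite_adj x y = (y - x \notin part_subgroup m n).
Proof.
rewrite /multipartite_adj; congr negb; rewrite -opprB.
move: (y - x) => z; rewrite -[z]natr_Zp pmulrn -rmorphN !part_intr.
by rewrite rpredN.
Qed.

End Multipartite.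

Section Sufficiency.

Variables m n : nat.
Hypotheses (m1 : (1 < m)%N) (n1 : (1 < n)%N) (en : ~~ odd n).
Let N := (m * n)%N.
Let N1 : (1 < N)%N. Proof. by rewrite /N; nia. Qed.

Variable Bs : seq (seq int).
Hypothesis Bs_base : forall s, s \in Bs -> base_cycle N s.
Hypothesis Bs_size : (2 * size (flatten Bs) = n * m.-1)%N.
Hypothesis Bs_cover : forall x : nat, (0 < x)%N -> (2 * x < N)%N -> ~~ (m %| x)%N ->
  exists2 d : int, d \in flatten Bs & (N %| d - x%:Z)%Z || (N %| d + x%:Z)%Z.

Let D : seq 'Z_N := [seq d%:~R | d <- flatten Bs].

Let D_cover (x : 'Z_N) : x \notin part_subgroup m n -> x \in D ++ map -%R D.
Proof.
have half (y : nat) : (y < N)%N -> (2 * y < N)%N -> ~~ (m %| y)%N ->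
    (y%:R \in D ++ map -%R D) /\ (- y%:R \in D ++ map -%R D).
  move=> yN y2 my; have y0 : (0 < y)%N by case: y my {yN y2}; rewrite ?dvdn0.
  have memD z : z \in D -> z \in D ++ map -%R D /\ - z \in D ++ map -%R D.
    by move=> zD; rewrite !mem_cat zD (map_f -%R zD) orbT.
  case: (Bs_cover y0 y2 my) => d dB H; have /memD[dD dD'] : d%:~R \in D by apply: map_f.
  case/orP: H => H.
    by have -> : y%:R = d%:~R :> 'Z_N by apply/eqP; rewrite eq_sym pmulrn intr_Zp_eq.
  have -> : y%:R = - d%:~R :> 'Z_N; last by rewrite opprK.
  by apply/eqP; rewrite eq_sym pmulrn -rmorphN intr_Zp_eq // -opprD rpredN.
rewrite part_val // => mx.
have xN : (x < N)%N by rewrite -[X in (_ < X)%N](Zp_cast N1).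
case: (ltngtP (2 * x) N) => c2.
- by rewrite -[x]natr_Zp; case: (half x xN c2 mx).
- have mNx : ~~ (m %| N - x)%N by rewrite dvdn_subr ?dvdn_mulr // ltnW.
  have [||_] := half (N - x)%N _ _ mNx; [lia|lia|].
  rewrite natrB ?(ltnW xN) //.
  by rewrite (_ : N%:R = 0 :> 'Z_N) ?sub0r ?opprK ?natr_Zp //; apply: pchar_Zp.
(* In the remaining case [2 * x = N], [x] is [m] times [n./2], a multiple of [m] because [n] is
   even. *)
case/negP: mx; apply/dvdnP; exists n./2.
by have := even_halfK en; rewrite -muln2; move: c2; rewrite /N; nia.
Qed.

(* [D] and its opposites are exactly as many as the targets they cover. *)
Let D_exact : uniq (D ++ map -%R D) /\ D ++ map -%R D =i [set x | x \notin part_subgroup m n].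
Proof.
have sz : (size (D ++ map -%R D) <= size (enum [set x | x \notin part_subgroup m n]))%N.
  by rewrite -cardE card_nonpart // size_cat !size_map; lia.
have sub : {subset enum [set x | x \notin part_subgroup m n] <= D ++ map -%R D}.
  by move=> x; rewrite mem_enum inE => /D_cover.
split; first exact: (leq_size_uniq (enum_uniq _) sub sz).
by move=> x; have [_ <-] := uniq_min_size (enum_uniq _) sub sz; rewrite mem_enum.
Qed.

Let c (s : seq int) (j : nat) : 'Z_N := (psum s j)%:~R.

Let c_inj s : s \in Bs -> forall i j, c s i = c s j <-> i = j %[mod #|'Z_N|].
Proof.
move=> /Bs_base sb i j; rewrite card_Zp_ring // -(psum_inj (ltnW N1) sb) /c.
by rewrite -intr_Zp_eq //; split=> [->|/eqP].
Qed.

Let C (s : seq int) : {set {set 'Z_N}} := [set [set c s i; c s i.+1] | i : 'I_#|'Z_N|].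

Let C_enum s : s \in Bs -> enumerates (c s) (C s).
Proof. by move=> sB; apply/enum_edges/c_inj. Qed.

Let step (s : seq int) j : c s j.+1 = c s j + (s`_(j %% size s))%:~R.
Proof. by rewrite /c psumS rmorphD. Qed.

Let stepD s j : s \in Bs -> (s`_(j %% size s))%:~R \in D.
Proof.
move=> sB; apply: map_f; apply/flattenP; exists s => //.
by rewrite mem_nth // ltn_pmod //; case: (Bs_base sB).
Qed.

(** Coinciding translates collapse in the set, so stabilisers require no separate treatment. *)
Let FF : {set {set {set {set 'Z_N}}}} :=
  [set [set translate_cycle g (C (nth [::] Bs i))] | i : 'I_(size Bs), g : 'Z_N].

Let FFP F : F \in FF -> exists s g, s \in Bs /\ F = [set translate_cycle g (C s)].
Proof.
by case/imset2P=> i g _ _ ->; exists (nth [::] Bs i), g; rewrite mem_nth.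
Qed.

Let FF_mem s g : s \in Bs -> [set translate_cycle g (C s)] \in FF.
Proof.
move=> sB; apply/imset2P.
have lt : (index s Bs < size Bs)%N by rewrite index_mem.
by exists (Ordinal lt) g; rewrite //= nth_index.
Qed.

(** The entries of [D] are distinct, so the common step determines the base cycle and the position
    in it mod its length. From there on the two translates take the same steps. *)
Let same_edge s s' g g' j j' :
  s \in Bs -> s' \in Bs -> c s j + g = c s' j' + g' ->
  c s j.+1 + g = c s' j'.+1 + g' -> translate_cycle g (C s) = translate_cycle g' (C s').
Proof.
move=> sB sB' E0 E1.
have E : (s`_(j %% size s))%:~R = (s'`_(j' %% size s'))%:~R :> 'Z_N.
  by move: E1; rewrite !step !(addrAC _ _%:~R) E0 => /addrI.
have [uD _] := D_exact; move: uD; rewrite cat_uniq => /andP[uD _].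
have uB := map_uniq uD.
have mem t i : t \in Bs -> t`_(i %% size t) \in t.
  by move=> tB; rewrite mem_nth // ltn_pmod //; case: (Bs_base tB).
have E' : s`_(j %% size s) = s'`_(j' %% size s').
  by apply: (map_uniq_inj uD) E; apply/flattenP; [exists s|exists s'] => //; apply: mem.
have ss : s = s' by apply: (flatten_uniq_eq uB sB sB' (mem s j sB)); rewrite E'; apply: mem.
subst s'.
have jj : (j %% size s = j' %% size s)%N.
  apply/eqP; rewrite -(nth_uniq 0 _ _ (flatten_uniq uB sB)) ?E' //;
  by rewrite ltn_pmod //; case: (Bs_base sB).
apply: (enum_shift_edges (i := j) (j := j') (enum_translate g (C_enum sB))
  (enum_translate g' (C_enum sB))).
elim=> [|l IH]; first by rewrite !addn0.
rewrite !addnS !step !(addrAC _ _%:~R) IH; congr (_ + _%:~R); congr nth.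
by rewrite -[LHS]modnDml jj modnDml.
Qed.

Lemma cyclic_factorization_of_base :
  exists FF : {set {set {set {set 'Z_(m * n)}}}},
    is_hamiltonian_2factorization (@multipartite_adj m n) FF /\ is_cyclic FF.
Proof.
have [uD memD] := D_exact.
have V3 : (2 < #|'Z_N|)%N.
  by rewrite card_Zp_ring // /N; have: (n != 3)%N; [case: eqP en => // -> | nia].
have Ch s g : s \in Bs -> is_hamiltonian_cycle (@multipartite_adj m n) (translate_cycle g (C s)).
  move=> sB; apply: enum_hamiltonian (enum_translate g (C_enum sB)) _ => // i.
  rewrite multipartite_adjP //= opprD addrACA subrr addr0 step [_ - _]addrC addKr.
  have : (s`_(i %% size s))%:~R \in D ++ map -%R D by rewrite mem_cat stepD.
  by rewrite memD inE.
exists FF; split; last first.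
  move=> F g /FFP[s [h [sB ->]]].
  by rewrite translate_set1 translate_cycleD FF_mem.
split; last first.
  by move=> F /FFP[s [h [sB ->]]]; exists (translate_cycle h (C s)) => //; apply: Ch.
split.
  move=> F /FFP[s [h [sB ->]]]; have [cy cov] := Ch s h sB.
  split=> [B /set1P->//|x].
  exists (translate_cycle h (C s)); split; first by rewrite set11 cov inE.
  by move=> B [/set1P->].
move=> e /imset2P[x y _]; rewrite !inE /= multipartite_adjP // => xy ->.
have cover1 B : cover [set B] = B :> {set {set 'Z_N}} by rewrite /cover big_set1.
have uniqF s s' g g' : s \in Bs -> s' \in Bs ->
    [set x; y] \in translate_cycle g (C s) -> [set x; y] \in translate_cycle g' (C s') ->
    translate_cycle g (C s) = translate_cycle g' (C s').
  move=> sB sB'.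
  have [_ E] := enum_translate g (C_enum sB); have [_ E'] := enum_translate g' (C_enum sB').
  move=> /E[i ->] /E'[j]; case/set2_eq=> [[E0 E1]|[E0 E1]]; first exact: same_edge E0 E1.
  (* Opposite directions on the same edge would give opposite steps, but [D] and its image under
     negation are disjoint. *)
  exfalso; move: uD; rewrite cat_uniq => /and3P[_ /hasPn H _].
  move: E1; rewrite step addrAC E0 step => E1.
  have {}E1 : (s`_(i %% size s))%:~R = - (s'`_(j %% size s'))%:~R :> 'Z_N.
    apply/eqP; rewrite -addr_eq0; apply/eqP/(addrI (c s' j + g')).
    by rewrite addr0 -[RHS]E1; ring.
  have := H (s`_(i %% size s))%:~R; rewrite stepD // E1 => /(_ _)/negP; apply=> //.
  by rewrite map_f // stepD.
have : y - x \in D ++ map -%R D by rewrite memD inE.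
(* The base cycle containing the step [z] is translated so that this step starts at [w]. *)
have ex z w : z \in D -> [set w; w + z] = [set x; y] ->
    exists s g, s \in Bs /\ [set x; y] \in translate_cycle g (C s).
  case/mapP=> d /flattenP[s sB ds] -> <-.
  exists s, (w - c s (index d s)); split=> //.
  have [_ ->] := enum_translate (w - c s (index d s)) (C_enum sB).
  exists (index d s); rewrite step modn_small ?index_mem // nth_index //.
  by congr [set _; _]; ring.
rewrite mem_cat => H.
have [s [g [sB xyC]]] : exists s g, s \in Bs /\ [set x; y] \in translate_cycle g (C s).
  case/orP: H => [|/mapP[z zD zE]]; first by move/(ex _ x); apply; rewrite [x + _]addrC subrK.
  by apply: (ex z y) => //; rewrite setUC; congr [set _; _]; rewrite -[z]opprK -zE; ring.
exists [set translate_cycle g (C s)]; split; first by rewrite FF_mem // cover1.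
by move=> F [/FFP[s' [g' [sB' ->]]]]; rewrite cover1 => H'; congr [set _]; apply: uniqF.
Qed.

End Sufficiency.

(** * Necessary conditions *)

(** A rotation brings the edge to the front; if it is traversed from [y] to [x], the reversed
    enumeration does so. *)
Lemma edge_enum (V : finType) (c : nat -> V) C x y : (2 < #|V|)%N ->
  enumerates c C -> [set x; y] \in C ->
  exists c', [/\ enumerates c' C, c' 0%N = x & c' 1%N = y].
Proof.
move=> V3 cC; have [ci CE] := cC => /CE[i /set2_eq[] [-> ->]]; last first.
  exists (fun l => c (i.+1 + #|V|.-1 * l)%N); split; first exact: enum_reverse.
    by rewrite muln0 addn0.
  by apply/ci; rewrite muln1 addSn -addnS prednK ?modnDr //; lia.
exists (fun l => c (i + l)%N); rewrite addn0 addn1; split=> //.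
split=> [j k|e]; first by rewrite ci; split=> /eqP; rewrite ?eqn_modDl => /eqP // E; apply/eqP; rewrite eqn_modDl E.
rewrite CE; split=> -[j ->]; last by exists (i + j)%N; rewrite addnS.
exists (j + i * #|V|.-1)%N; congr [set _; _]; apply/ci.
  by have -> : (i + (j + i * #|V|.-1) = i * #|V| + j)%N; [nia | rewrite modnMDl].
by have -> : (i + (j + i * #|V|.-1).+1 = i * #|V| + j.+1)%N; [nia | rewrite modnMDl].
Qed.

Section Necessity.

Variables m n : nat.
Hypotheses (m1 : (1 < m)%N) (n1 : (1 < n)%N) (mn_even : ~~ odd (m * n)).
Let N := (m * n)%N.
Let N1 : (1 < N)%N. Proof. by rewrite /N; nia. Qed.
Let V3 : (2 < #|'Z_(m * n)|)%N.
Proof. by rewrite card_Zp_ring // -/N; move: mn_even; rewrite -/N; lia. Qed.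
Notation V := ('Z_(m * n)).

Variable FF : {set {set {set {set V}}}}.
Hypothesis HFF : is_hamiltonian_2factorization (@multipartite_adj m n) FF.
Hypothesis cFF : is_cyclic FF.

Let X := [set C | [set C] \in FF].

Let X_enum C : C \in X -> exists2 c, enumerates c C & forall i, multipartite_adj (c i) (c i.+1).
Proof.
rewrite inE => /(proj2 HFF)[C' hC' /set1_inj ->]; exact: hamiltonian_enum hC'.
Qed.

Let X_translate C g : C \in X -> translate_cycle g C \in X.
Proof. by rewrite !inE => /(@cFF _ g); rewrite translate_set1. Qed.

Let cover1 (B : {set {set V}}) : cover [set B] = B.
Proof. by rewrite /cover big_set1. Qed.

Let edgeE (x y : V) : multipartite_adj x y ->
  exists2 C, C \in X /\ [set x; y] \in C & forall C', C' \in X -> [set x; y] \in C' -> C' = C.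
Proof.
move=> xy; have eE : [set x; y] \in edges (@multipartite_adj m n).
  by apply/imset2P; exists x y; rewrite ?inE.
have [F [[FFF eF] uF]] := proj2 (proj1 HFF) _ eE.
have [C _ FE] := proj2 HFF _ FFF; rewrite FE cover1 in eF.
exists C; first by rewrite inE -FE.
move=> C'; rewrite inE => C'F eC'; apply/set1_inj; rewrite -FE; symmetry.
by apply: uF; rewrite cover1.
Qed.

Let adjC (x y : V) : multipartite_adj x y = multipartite_adj y x.
Proof. by rewrite multipartite_adjP. Qed.

Let X_adj C x y : C \in X -> [set x; y] \in C -> multipartite_adj x y.
Proof.
move=> /X_enum[c [_ CE] cadj] /CE[i /set2_eq[] [-> ->]] //.
by rewrite adjC.
Qed.

Let X_uniq C C' x y : C \in X -> C' \in X -> [set x; y] \in C -> [set x; y] \in C' -> C = C'.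
Proof.
move=> CX C'X xyC xyC'; have [C0 _ H] := edgeE (X_adj CX xyC).
by rewrite (H C CX xyC) (H C' C'X xyC').
Qed.

(** Double counting of the edges at [0]: by the cycle that contains them, and by their other end. *)
Let card_X : (2 * #|X| = n * m.-1)%N.
Proof.
have deg C : C \in X -> #|[set y | [set 0; y] \in C]| = 2.
  move=> /X_enum[c cC _]; have [ci CE] := cC.
  have [a a0] := enum_surj 0 cC.
  have [y0 yC] : exists y, [set 0; y] \in C by exists (c a.+1); apply/CE; exists a; rewrite a0.
  have [c' [c'C c0 c1]] := edge_enum V3 cC yC; have [ci' CE'] := c'C.
  have M3 := V3; set M := #|V| in M3 ci'.
  have cM : c' M = 0 by rewrite -c0; apply/ci'; rewrite modnn mod0n.
  have -> : [set y | [set 0; y] \in C] = [set c' 1%N; c' M.-1].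
    apply/setP => y; rewrite !inE; apply/idP/orP => [|[]/eqP->].
    - have : M.-1.+1 = M by lia.
      move=> ME; rewrite -cM -{1}ME => /(enum_neighbor V3 c'C)[->|->]; first by right.
      by left; rewrite ME; apply/eqP/ci'; rewrite -[M.+1]add1n modnDr.
    - by apply/CE'; exists 0%N; rewrite c0.
    by apply/CE'; exists M.-1; rewrite prednK ?cM 1?setUC //; lia.
  rewrite cards2; case: eqP => // /ci'; rewrite !modn_small; lia.
have -> : (n * m.-1)%N = #|[set y : V | multipartite_adj 0 y]|.
  rewrite -card_nonpart //; apply: eq_card => y.
  by rewrite !inE multipartite_adjP // subr0.
rewrite mulnC -sum_nat_const -(eq_bigr _ deg) -sum1_card.
under eq_bigr do rewrite -sum1_card.
rewrite (exchange_big_dep (fun y => y \in [set y | multipartite_adj 0 y])) /=; last first.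
  by move=> C y CX; rewrite !inE => /(X_adj CX).
apply: eq_bigr => y; rewrite inE => /edgeE[C [CX yC] uC].
rewrite (big_pred1 C) // => C'; apply/andP/eqP => [[C'X]|->]; last by rewrite [y \in _]inE.
by rewrite [y \in _]inE; apply: uC.
Qed.

(** If [n] were odd, [m] would be even and [n * m.-1] odd, against [card_X]. *)
Lemma parts_even : ~~ odd n.
Proof.
apply/negP => on; have em : ~~ odd m by move: mn_even; rewrite oddM on andbT.
move: card_X => /(congr1 odd); rewrite !oddM on /=; case: m em m1 => // k /=.
by rewrite negbK => ->.
Qed.

Let translate_edge (C : {set {set V}}) (g x y : V) : [set x; y] \in C -> [set x + g; y + g] \in translate_cycle g C.
Proof. by rewrite -translate_set2; apply: imset_f. Qed.

Let translate_multiple (C : {set {set V}}) (g : V) t : translate_cycle g C = C -> translate_cycle (g *+ t) C = C.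
Proof.
move=> gC; elim: t => [|t IH]; first by rewrite mulr0n translate_cycle0.
by rewrite mulrS -translate_cycleD gC IH.
Qed.

Let translate_opp (C : {set {set V}}) (g : V) : translate_cycle g C = C -> translate_cycle (- g) C = C.
Proof. by move=> {1}<-; rewrite translate_cycleD subrr translate_cycle0. Qed.

Lemma not_odd_prime_power p a : n = 2%N -> prime p -> odd p -> (0 < a)%N -> m <> (p ^ a)%N.
Proof.
move=> n2 pp op a0 mE; have p2 := prime_gt1 pp.
have mp : m = (p * p ^ a.-1)%N by rewrite mE -{1}(prednK a0) expnS.
set q := (p ^ a.-1)%N in mp; have q0 : (0 < q)%N by rewrite expn_gt0 ltnW.
pose d : V := (2 * q)%:R.
have d_adj : multipartite_adj 0 d.
  rewrite multipartite_adjP // subr0 /d pmulrn part_intr // dvdzE /= mp dvdn_pmul2r //.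
  by apply/negP => /dvdn_leq -/(_ isT) p_le; move: p_le p2 op; lia.
have [C [CX dC] _] := edgeE d_adj.
(* Pigeonhole: for [n = 2] there are only [m - 1] cycles, so two of the [m] translates of [C]
   coincide. *)
have [i [j [ij gC]]] : exists i j : 'I_m, (i < j)%N /\ translate_cycle (j - i)%:R C = C.
  pose f (i : 'I_m) : {set {set V}} := translate_cycle i%:R C.
  have /injectivePn [i [j ij fij]] : ~~ injectiveb f.
    apply/negP => /injectiveP inj_f.
    have : (#|[set f i | i : 'I_m]| <= #|X|)%N.
      by apply/subset_leq_card/subsetP => _ /imsetP[k _ ->]; apply: X_translate.
    by rewrite card_imset // card_ord; have := card_X; nia.
  wlog lt : i j ij fij / (i < j)%N.
    move=> W; case: (ltngtP i j) => [lt|gt|/val_inj E]; last by rewrite E eqxx in ij.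
      exact: (W i j).
    by apply: (W j i) => //; rewrite eq_sym.
  exists i, j; split=> //; rewrite natrB ?(ltnW lt) // -translate_cycleD -/(f j) -fij.
  by rewrite translate_cycleD subrr translate_cycle0.
set g := (j - i)%N in gC; have g0 : (0 < g)%N by rewrite subn_gt0.
have gm : (g < m)%N by rewrite /g; have := ltn_ord j; lia.
have NE : N = (2 * m)%N by rewrite /N n2 mulnC.
(* Since [0 < g < m], the gcd of [D] and [m] is a proper divisor of [p ^ a], hence divides [q]. Thus
   [d] is a multiple of [g] in ['Z_N], and it also fixes [C]. *)
have gd : (gcdn N g %| 2 * q)%N.
  set D := gcdn N g.
  have D2 : (D %| 2 * gcdn D m)%N.
    by rewrite muln_gcdr dvdn_gcd dvdn_mull // -NE dvdn_gcdl.
  apply: dvdn_trans D2 _; rewrite dvdn_pmul2l //.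
  have : (gcdn D m %| p ^ a)%N by rewrite -mE dvdn_gcdr.
  case/(dvdn_pfactor _ _ pp) => k ka kE.
  rewrite kE /q dvdn_exp2l // -ltnS prednK // ltn_neqAle ka andbT.
  apply/eqP => kaE; suff : (m <= g)%N by rewrite leqNgt gm.
  apply: dvdn_leq => //; rewrite mE -kaE -kE.
  by apply: dvdn_trans (dvdn_gcdl _ _) (dvdn_gcdr _ _).
have dCd : translate_cycle d C = C.
  have [a' _ aE] := @Bezoutl N g (ltnW N1); have [r rE] := dvdnP gd.
  have -> : d = - (g%:R *+ (r * a')).
    apply/eqP; rewrite -addr_eq0 /d -mulrnA -natrD pmulrn intr_Zp_eq0 // dvdzE /=.
    rewrite rE (_ : (_ + _)%N = (r * (gcdn N g + a' * g))%N); last by nia.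
    exact: dvdn_mull.
  exact/translate_opp/translate_multiple.
have [c0 c0C _] := X_enum CX.
have [c [cC c_0 c_1]] := edge_enum V3 c0C dC.
have c'C : enumerates (fun l => c l + d) C by rewrite -dCd; apply: enum_translate.
(* Translation by [d] sends the edge from [0] to [d] to an edge from [d] to [2 d], and [2 d] is
   nonzero because [p] is odd; so the cycle continues there. *)
have d2 : c 1%N + d = c 2.
  have : [set c 1%N; c 1%N + d] \in C.
    by rewrite -dCd -{1}[c 1%N]add0r c_1 -[X in [set X; _]]add0r addrA addr0 translate_edge.
  case/(enum_neighbor V3 cC) => [/eqP H|-> //]; exfalso; move: H; rewrite c_0 c_1 /d -natrD pmulrn intr_Zp_eq0 // dvdzE /=.
  rewrite -/N NE mp -mulnDr dvdn_pmul2l // addnn -muln2 mulnC dvdn_pmul2l //.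
  by move=> /dvdn_leq -/(_ isT) p_le; move: p_le p2 op; lia.
have rot := @enum_rotation _ _ _ _ 0 1 V3 c'C cC.
have cl l : c l = d *+ l.
  elim: l => [|l IH]; first by rewrite mulr0n.
  by rewrite mulrS addrC -IH -[l.+1]add1n -rot // ?c_0 ?add0r // c_1.
(* All vertices would be multiples of [d]. Both [d] and [N] are even, so [1] is missed. *)
have [l] := enum_surj 1 cC; rewrite cl /d -mulrnA => /eqP.
rewrite eq_sym pmulrn -[X in _ == X]mulr1z intr_Zp_eq // => H.
have : (2 %| (2 * q * l)%N%:Z - 1)%Z by apply: dvdz_trans H; rewrite -/N NE PoszM dvdz_mulr.
by clear; lia.
Qed.

Let odd_valD (x y : V) : odd (val (x + y)) = odd (val x) (+) odd (val y).
Proof.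
rewrite /= [(_ %% _)%N](_ : _ = ((x + y) %% N)%N); last by congr (_ %% _)%N; rewrite Zp_cast.
have := divn_eq (x + y) N => /(congr1 odd); rewrite !oddD oddM (negPf mn_even) andbF.
by move=> ->.
Qed.

Let half_part (g : V) : ~~ odd n -> g + g = 0 -> g \in part_subgroup m n.
Proof.
move=> en; rewrite -{1 2}[g]natr_Zp -natrD part_val // pmulrn => /eqP.
rewrite intr_Zp_eq0 // dvdzE /= => /dvdnP[r rE].
apply/dvdnP; exists (r * n./2)%N; move: rE.
by have := even_halfK en; rewrite -muln2 /N; nia.
Qed.

Let diffs (C : {set {set V}}) := [set x : V | [exists y, [set y; y + x] \in C]].
Let even_diffs (C : {set {set V}}) := [set x in diffs C | ~~ odd (val x)].

Let diffs_translate (C : {set {set V}}) (g : V) : diffs (translate_cycle g C) = diffs C.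
Proof.
suff sub D h : diffs D \subset diffs (translate_cycle h D).
  apply/eqP; rewrite eqEsubset sub andbT.
  by apply: subset_trans (sub _ (- g)) _; rewrite translate_cycleD subrr translate_cycle0.
apply/subsetP => x; rewrite !inE => /existsP[y yC]; apply/existsP; exists (y + h).
by rewrite addrAC translate_edge.
Qed.

(* With [k] the least period of the steps of [C] and [gam = c k - c 0], the order
   of [gam] is [N / k], so [gam] and [k] have the same parity, and the number of
   odd steps in a period has the parity of [gam]. *)
Let card_even_diffs C : ~~ odd n -> C \in X -> (4 %| #|even_diffs C|)%N.
Proof.
move=> en CX; have [c cC cadj] := X_enum CX; have [ci CE] := cC.
have VN : #|V| = N by rewrite card_Zp_ring.
have trC i j g : [set c i + g; c i.+1 + g] = [set c j; c j.+1] -> translate_cycle g C = C.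
  move=> E; apply: (X_uniq (x := c j) (y := c j.+1)); rewrite ?X_translate //.
    by rewrite -E translate_edge //; apply/CE; exists i.
  by apply/CE; exists j.
(* A period is a number of steps whose effect is a fixed translation. [N] is one, so a least one
   exists. *)
pose period k := (0 < k)%N && [forall j : 'I_N, c (j + k)%N == c j + (c k - c 0%N)].
have periodP k : period k -> forall j, c (j + k)%N = c j + (c k - c 0%N).
  case/andP=> k0 /forallP H j; have N0 := ltnW N1.
  have := H (Ordinal (ltn_pmod j N0)) => /= /eqP.
  have -> : c (j %% N)%N = c j by apply/ci; rewrite VN modn_mod.
  by have -> : c (j %% N + k)%N = c (j + k)%N by apply/ci; rewrite VN modnDml.
have cN j : c (j + N)%N = c j by apply/ci; rewrite VN modnDr.
have perN : period N.
  by rewrite /period ltnW //=; apply/forallP => j; rewrite cN (cN 0%N : c N = _) subrr addr0.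
have exk : exists k, period k by exists N.
case: (ex_minnP exk) => k perk kmin.
have k0 : (0 < k)%N by case/andP: perk.
have kN : (k <= N)%N by apply: kmin.
have ck := periodP _ perk.
have [gam gamE] : exists gam, gam = c k - c 0%N by exists (c k - c 0%N).
rewrite -gamE in ck.
have ckq q : c (q * k)%N = c 0%N + gam *+ q.
  elim: q => [|q IH]; first by rewrite mulr0n addr0.
  by rewrite mulSnr ck IH mulrSr [RHS]addrA.
(* Both parities are tested by the factor [N./2]: [N] divides [N./2 * x] exactly when [x] is even,
   and index [N./2 * k] is back at [c 0] exactly when [gam *+ N./2 = 0]. *)
have gam_odd : odd (val gam) = odd k.
  have half_dvd x : (N %| N./2 * x)%N = ~~ odd x.
    have NE : N = (N./2 * 2)%N by rewrite muln2 even_halfK.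
    have h0 : (0 < N./2)%N by move: N1 NE; clear; lia.
    by rewrite {1}NE dvdn_pmul2l // dvdn2.
  have : (c (N./2 * k)%N == c 0%N) = (gam *+ N./2 == 0).
    by rewrite ckq -[X in _ == X]addr0 (inj_eq (addrI _)).
  have -> : (c (N./2 * k)%N == c 0%N) = ~~ odd k.
    rewrite -half_dvd /dvdn -[X in _ = (_ == X)](mod0n N) -VN.
    by apply/eqP/eqP => /ci.
  rewrite -{1}[gam]natr_Zp -mulrnA pmulrn intr_Zp_eq0 // dvdzE /= [(gam * _)%N]mulnC half_dvd.
  by case: (odd k); case: (odd gam).
have [d dE] : exists d, forall j, d j = c j.+1 - c j by exists (fun j => c j.+1 - c j).
have cd j : c j.+1 = c j + d j by rewrite dE addrC subrK.
have odd_sum j : odd (val (c j - c 0%N)) = odd (\sum_(i < j) odd (val (d i))).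
  elim: j => [|j IH]; first by rewrite subrr big_ord0.
  by rewrite cd addrAC odd_valD IH big_ord_recr oddD; congr (_ (+) _); case: (odd _).
have odd_count : odd (val (c k - c 0%N)) = odd #|[set i : 'I_k | odd (val (d i))]|.
  rewrite odd_sum -sum1_card [in RHS]big_mkcond /=; congr odd.
  by apply: eq_bigr => i _; rewrite inE; case: (odd _).
have even_count : ~~ odd #|[set i : 'I_k | ~~ odd (val (d i))]|.
  have := cardsC [set i : 'I_k | odd (val (d i))]; rewrite card_ord => /(congr1 odd).
  rewrite oddD -odd_count -gamE gam_odd.
  have -> : ~: [set i : 'I_k | odd (val (d i))] = [set i : 'I_k | ~~ odd (val (d i))].
    by apply/setP => i; rewrite !inE.
  by case: (odd k); case: (odd _).
have oddN (x : V) : odd (val (- x)) = odd (val x).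
  by have := odd_valD x (- x); rewrite subrr /=; case: (odd x); case: (odd (- x)%R).
have d_nonpart i : d i \notin part_subgroup m n.
  by rewrite dE -multipartite_adjP.
(* Equal steps at [i] and [j] give a translation that fixes [C] and preserves its direction; then
   [j - i] is a period smaller than [k]. *)
have d_inj i j : (i < j < k)%N -> d i <> d j.
  case/andP=> ij jk dij; pose g := c j - c i.
  have E0 : c i + g = c j by rewrite addrC subrK.
  have E1 : c i.+1 + g = c j.+1 by rewrite !cd addrAC E0 dij.
  have gC : translate_cycle g C = C by apply: (trC i j); rewrite E0 E1.
  have c'C : enumerates (fun l => c l + g) C by rewrite -gC; apply: enum_translate.
  have rot := enum_rotation V3 c'C cC E0 E1.
  have cg b : c (b + (j - i))%N = c b + g.
    have -> : c b = c (i + (b + i * N.-1))%N.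
      by apply/ci; rewrite VN (_ : (i + _ = i * N + b)%N) ?modnMDl //; have := N1; nia.
    rewrite rot; apply/ci; rewrite VN (_ : (j + _ = i * N + (b + (j - i)))%N) ?modnMDl //.
    by have := N1; nia.
  suff : (k <= j - i)%N by move: ij jk; clear; lia.
  apply: kmin; rewrite /period subn_gt0 ij /=; apply/forallP => b.
  by rewrite cg -[X in c X - _]add0n cg [_ + g - _]addrC addKr.
(* Opposite steps give a translation that reflects the cycle. A reflection of a cycle of even length
   fixes a vertex, so that [g = 0], or an edge, so that [g] is a step of order 2; but elements with
   [g + g = 0] lie in the part subgroup. *)
have d_opp i j : d i <> - d j.
  move=> dij; pose g := c j.+1 - c i.
  have E0 : c i + g = c j.+1 by rewrite addrC subrK.
  have E1 : c i.+1 + g = c j by rewrite cd addrAC E0 dij cd addrK.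
  have gC : translate_cycle g C = C by apply: (trC i j); rewrite E0 E1 setUC.
  have c'C : enumerates (fun l => c l + g) C by rewrite -gC; apply: enum_translate.
  have rot := enum_rotation V3 c'C (enum_reverse j.+1 V3 cC).
  have {}rot l : c (i + l)%N + g = c (j.+1 + N.-1 * l)%N.
    rewrite -VN -[l in RHS]add0n; apply: rot; rewrite ?muln0 ?addn0 ?E0 // E1.
    by apply/ci; rewrite muln1 addSn -addnS prednK ?modnDr // VN ltnW.
  (* [e] is a nonnegative representative of [j + 1 - i] mod [N]. The reflection exchanges the
     indices [i + l] and [i + (e - l)], so its centre is an edge or a vertex according to the parity
     of [e]. *)
  have [e eE] : exists e, (i + e = j.+1 + N * i.+1)%N by exists (j.+1 + N * i.+1 - i)%N; nia.
  have back l : (l <= e)%N -> c (i + l)%N + g = c (i + (e - l))%N.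
    move=> le; rewrite rot; apply/ci; rewrite VN.
    have A : (j.+1 + N.-1 * l + l = l * N + j.+1)%N.
      by rewrite -addnA -mulSnr prednK ?(ltnW N1) // addnC mulnC.
    have B : (i + (e - l) + l = i.+1 * N + j.+1)%N by rewrite -addnA subnK // eE addnC mulnC.
    by apply/eqP; rewrite -(eqn_modDr l) A B !modnMDl.
  have eo := odd_double_half e; rewrite -muln2 in eo.
  case oe: (odd e) eo => eo.
    have e1 := back e./2; have e2 := back e./2.+1.
    have D1 : (e - e./2 = e./2.+1)%N by lia.
    have D2 : (e - e./2.+1 = e./2)%N by lia.
    rewrite D1 in e1; rewrite D2 in e2; rewrite addnS in e1 e2.
    have g2 : g + g = 0.
      have le1 : (e./2 <= e)%N by lia.
      have le2 : (e./2.+1 <= e)%N by lia.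
      apply: (addrI (c (i + e./2)%N)); rewrite addr0 -[RHS]e2 // -e1 //.
      by rewrite addrA.
    have := d_nonpart (i + e./2)%N; rewrite dE -e1; last by lia.
    by rewrite [_ + g]addrC addrK half_part.
  have le1 : (e./2 <= e)%N by lia.
  have := back e./2 le1; have -> : (e - e./2 = e./2)%N by lia.
  rewrite -[RHS]addr0 => /addrI g0; move: E0 E1; rewrite g0 !addr0 => /ci ij /ci ji.
  have : 2 = 0 %[mod #|V|].
    apply/eqP; rewrite -(eqn_modDl j) addn0 -ji addn2 eqn_modS; apply/eqP.
    by rewrite ij.
  by rewrite mod0n modn_small.
(* The even differences are the even steps of one period with both signs, all distinct by [d_inj]
   and [d_opp]: twice an even number. *)
have -> : even_diffs C = [set (if p.2 then d p.1 else - d p.1) |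
    p : 'I_k * bool in setX [set i : 'I_k | ~~ odd (val (d i))] [set: bool]].
  have dper i : d (i + k)%N = d i.
    by rewrite !dE -addSn !ck opprD addrACA subrr addr0.
  have dk j : d (j %% k)%N = d j.
    rewrite [in RHS](divn_eq j k); elim: (j %/ k)%N => // q IH.
    by rewrite IH mulSn -addnA [(k + _)%N]addnC dper.
  apply/setP => x; rewrite inE; apply/andP/imsetP => [[]|].
    rewrite inE => /existsP[y /CE[j E]] ex.
    have kj := ltn_pmod j k0.
    case: (set2_eq E) => -[E0 E1].
      have xE : x = d (j %% k)%N by rewrite dk dE -E1 -E0 [_ - y]addrC addKr.
      have ex' : ~~ odd (val (d (j %% k)%N)) by rewrite -xE.
      by exists (Ordinal kj, true) => //; rewrite in_setX in_setT andbT in_set.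
    have xE : x = - d (j %% k)%N by rewrite dk dE -E1 -E0 opprB [_ - y]addrC addKr.
    have ex' : ~~ odd (val (d (j %% k)%N)) by rewrite -oddN -xE.
    by exists (Ordinal kj, false) => //; rewrite in_setX in_setT andbT in_set.
  case=> -[i b]; rewrite in_setX in_setT andbT in_set => ei ->.
  have eC : [set c i; c i.+1] \in C by apply/CE; exists i.
  case: b; split; rewrite ?oddN // ?inE; apply/existsP; [exists (c i)|exists (c i.+1)].
    by rewrite -cd.
  by rewrite setUC {1}cd addrK.
rewrite card_in_imset.
  by rewrite cardsX cardsT card_bool (_ : 4 = 2 * 2)%N // dvdn_pmul2r // dvdn2.
have inj (i j : 'I_k) : d i = d j -> i = j.
  move=> E; apply/val_inj; case: (ltngtP i j) => //= lt; exfalso.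
    by apply: (d_inj i j) => //; rewrite lt ltn_ord.
  by apply: (d_inj j i) => //; rewrite lt ltn_ord.
case=> i [] [j []] _ _ /=.
- by move=> /inj->.
- by move/d_opp.
- by move/esym/d_opp.
by move/oppr_inj/inj->.
Qed.

Lemma even_condition : ~~ odd n -> n = 2 %[mod 4] -> m = 1 %[mod 4] \/ m = 2 %[mod 4].
Proof.
move=> en n24.
pose Ev : {set V} := [set x | (x \notin part_subgroup m n) && ~~ odd (val x)].
(* Translates of a cycle share their even differences and are merged in this set. Cycles with a
   common difference are translates of each other, so [P] is a partition of [Ev]. *)
pose P := [set even_diffs C | C in X].
have coverP : cover P = Ev.
  apply/setP => x; rewrite [RHS]inE; apply/bigcupP/andP => [[_ /imsetP[C CX ->]]|[xp ex]].
    rewrite !inE => /andP[/existsP[y yC] ex]; split=> //.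
    by have := X_adj CX yC; rewrite multipartite_adjP // [_ + x]addrC addrK.
  have [|C [CX xC] _] := @edgeE 0 x; first by rewrite multipartite_adjP // subr0.
  exists (even_diffs C); first exact: imset_f.
  by rewrite !inE ex andbT; apply/existsP; exists 0; rewrite add0r.
have trivP : trivIset P.
  apply/trivIsetP => _ _ /imsetP[C CX ->] /imsetP[C' C'X ->].
  apply: contraR => /pred0Pn[x] /=; rewrite !inE => /andP[/andP[/existsP[y yC] _] /andP[/existsP[z zC] _]].
  have E : translate_cycle (z - y) C = C'.
    apply: (X_uniq (x := z) (y := z + x)); rewrite ?X_translate //.
    have zE : y + (z - y) = z by rewrite addrC subrK.
    by have := translate_edge (z - y) yC; rewrite addrAC zE.
  by apply/eqP/setP => w; rewrite !inE -E; have := diffs_translate C (z - y); move/setP/(_ w); rewrite !inE => ->.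
have : (4 %| #|Ev|)%N.
  rewrite -coverP; move: trivP; rewrite /trivIset => /eqP <-.
  by apply: dvdn_sum => _ /imsetP[C CX ->]; apply: card_even_diffs.
have two_N : (2 %| N)%N by rewrite dvdn2.
have evens := card_multiples N1 two_N.
have EvC : #|Ev| = (N %/ 2 - #|[set x : V | (m %| x) && (2 %| x)]|)%N.
  rewrite -evens -(cardsID [set x : V | (m %| x)%N] [set x : V | (2 %| x)%N]).
  rewrite (_ : _ :&: _ = [set x : V | (m %| x) && (2 %| x)]%N); last first.
    by apply/setP => x; rewrite !inE andbC.
  rewrite addKn; apply: eq_card => x.
  by rewrite !inE part_val // dvdn2 andbC.
have nE : n = (n./2 * 2)%N by rewrite muln2 even_halfK.
have NE : N = (m * n./2 * 2)%N by rewrite -mulnA -nE.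
have N2 : (N %/ 2 = m * n./2)%N by rewrite NE mulnK.
have cop : coprime 4 n./2.
  by rewrite (_ : 4 = 2 ^ 2)%N // coprimeXl // coprime2n; move: n24 nE; clear; lia.
(* The size of [Ev] is [n./2 * (m - 1)] for odd [m] and [n./2 * (m - 2)] for even [m], where [n./2]
   is odd. *)
rewrite EvC; have [om|em] := boolP (odd m).
  have m2N : (m * 2 %| N)%N by rewrite /N dvdn_pmul2l ?dvdn2 // ltnW.
  have -> : [set x : V | (m %| x) && (2 %| x)]%N = [set x : V | (m * 2 %| x)%N].
    by apply/setP => x; rewrite !inE Gauss_dvd // coprimen2.
  rewrite (card_multiples N1 m2N) N2 (_ : (N %/ (m * 2) = n./2)%N); last first.
    by rewrite NE mulnAC mulKn // muln_gt0 ltnW.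
  rewrite -[X in (_ - X)%N]mul1n -mulnBl mulnC Gauss_dvdr // => H; left.
  by move: H; lia.
have -> : [set x : V | (m %| x) && (2 %| x)]%N = [set x : V | (m %| x)%N].
  apply/setP => x; rewrite !inE andb_idr // => /(dvdn_trans _); apply.
  by rewrite dvdn2.
have mN : (m %| N)%N by rewrite /N dvdn_mulr.
have Nm : (N %/ m = n)%N by rewrite /N mulKn // ltnW.
rewrite (card_multiples N1 mN) N2 Nm => H; right.
have {}H : (4 %| n./2 * (m - 2))%N by rewrite mulnBr -nE mulnC.
by move: H m1 em; rewrite Gauss_dvdr //; clear; lia.
Qed.

End Necessity.

(** * Zigzags *)

Definition sg (i : nat) : int := if odd i then -1 else 1.

Lemma sgS i : sg i.+1 = - sg i.
Proof. by rewrite /sg /=; case: odd. Qed.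

(** Walecki's path, whose successive differences are 1, -2, 3, -4, and so on. *)
Definition zigzag (i : nat) : int := if odd i then (i.+1)./2%:Z else - i./2%:Z.

Lemma zigzagS i : zigzag i.+1 = zigzag i + sg i * i.+1%:Z.
Proof. rewrite /zigzag /sg [odd i.+1]/=; case: (boolP (odd i)) => oi /=; lia. Qed.

(** The first [k] terms fill an interval of [k] consecutive integers. *)
Lemma zigzag_inj i j k : (i < j < k)%N -> ~~ (k %| zigzag j - zigzag i)%Z.
Proof.
move=> /andP[ij jk]; apply/negP => /dvdzP[q].
have [->|[t|t]] : q = 0 \/ q <= -1 \/ 1 <= q by lia.
- by rewrite /zigzag; case: (boolP (odd i)); case: (boolP (odd j)); lia.
- have : q * k%:Z <= - k%:Z by nia.
  by rewrite /zigzag; case: (boolP (odd i)); case: (boolP (odd j)); lia.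
have : q * k%:Z >= k%:Z by nia.
by rewrite /zigzag; case: (boolP (odd i)); case: (boolP (odd j)); lia.
Qed.

Lemma walecki_psum (q : int) (s : seq int) k i : (i < k)%N -> (k <= size s)%N ->
  (forall l, (l.+1 < k)%N -> (k %| s`_l - sg l * (q * l.+1%:Z))%Z) ->
  (k %| psum s i - q * zigzag i)%Z.
Proof.
move=> + ks H; elim: i => [_|i IH ik]; first by rewrite /psum big_ord0 mulr0.
rewrite psumS zigzagS modn_small; last by apply: leq_trans ks; apply: ltnW.
rewrite (_ : _ - _ = (psum s i - q * zigzag i) + (s`_i - sg i * (q * i.+1%:Z))); last by ring.
by rewrite rpredD ?H // IH // ltnW.
Qed.

(** The partial sums are [q] times the zigzag mod [size s], and [q] is invertible. The last entry is
    constrained only through the total. *)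
Lemma walecki_base N (q u : int) (s : seq int) : (0 < size s)%N ->
  (size s %| N)%N -> coprimez q (size s) ->
  (forall i, (i.+1 < size s)%N -> (size s %| s`_i - sg i * (q * i.+1%:Z))%Z) ->
  psum s (size s) = (size s)%:Z * u -> coprimez u (N %/ size s)%N ->
  base_cycle N s.
Proof.
move=> s0 sN cq H su cu; split=> //; last by exists u.
move=> i j ijs; have [ij js] := andP ijs; apply: contra (zigzag_inj ijs) => D.
have Hi := walecki_psum (ltn_trans ij js) (leqnn _) H.
have Hj := walecki_psum js (leqnn _) H.
rewrite -(@Gauss_dvdzr _ q); last by rewrite coprimez_sym.
rewrite (_ : q * _ = (psum s j - psum s i) - (psum s j - q * zigzag j) + (psum s i - q * zigzag i)); last by ring.
by rewrite rpredD // rpredB.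
Qed.

Lemma psum_mkseq f k : psum (mkseq f k) k = \sum_(i < k) f i.
Proof.
rewrite /psum size_mkseq; apply: eq_bigr => i _.
by rewrite modn_small // nth_mkseq.
Qed.

(* When [g i] is [q (i + 1)] mod [2 h + 1], the partial sums are [q] times the
   zigzag and [x] is the step back to [0]. *)
Definition alt_cycle (h : nat) (g : nat -> int) (x : int) : seq int :=
  mkseq (fun i => if (i < 2 * h)%N then sg i * g i else x) (2 * h).+1.

Definition alt_sum (h : nat) (g : nat -> int) : int :=
  \sum_(i < h) (g (2 * i)%N - g (2 * i).+1).

Lemma alt_sumS k (g : nat -> int) :
  alt_sum k.+1 g = alt_sum k g + (g (2 * k)%N - g (2 * k).+1).
Proof. exact: big_ord_recr. Qed.

Lemma alt_sumE h (g : nat -> int) : \sum_(i < 2 * h) sg i * g i = alt_sum h g.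
Proof.
elim: h => [|h IH]; first by rewrite /alt_sum !big_ord0.
have -> : (2 * h.+1 = (2 * h).+2)%N by lia.
rewrite alt_sumS !big_ord_recr /= -IH.
by rewrite sgS /sg oddM /=; ring.
Qed.

Lemma alt_sum_affine h (A B : int) (g : nat -> int) : (forall i, (i < 2 * h)%N -> g i = A + B * i%:Z) ->
  alt_sum h g = - B * h%:Z.
Proof.
move=> gE; rewrite /alt_sum (eq_bigr (fun=> - B)).
  by rewrite big_const_ord iter_addr_0 -mulr_natr natz.
by move=> i _; have := ltn_ord i => ih; rewrite !gE; lia.
Qed.

Lemma alt_sum_shift h (A : int) (g f : nat -> int) : (forall i, f i = A + g i) ->
  alt_sum h f = alt_sum h g.
Proof. by move=> fE; apply: eq_bigr => i _; rewrite !fE; ring. Qed.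

Lemma alt_cycle_base N h (q u : int) (g : nat -> int) x :
  ((2 * h).+1 %| N)%N -> coprimez q (2 * h).+1 ->
  (forall i, (i < 2 * h)%N -> ((2 * h).+1 %| g i - q * i.+1%:Z)%Z) ->
  alt_sum h g + x = (2 * h).+1%:Z * u -> coprimez u (N %/ (2 * h).+1)%N ->
  base_cycle N (alt_cycle h g x).
Proof.
move=> kN cq H su cu.
have sz : size (alt_cycle h g x) = (2 * h).+1 by rewrite size_mkseq.
apply: (@walecki_base _ q u); rewrite ?sz //.
  move=> i ik; rewrite nth_mkseq; last by lia.
  by rewrite ltnS in ik; rewrite ik -mulrBr dvdz_mull // H.
rewrite /alt_cycle psum_mkseq big_ord_recr /= ltnn -su; congr (_ + _).
by rewrite -alt_sumE; apply: eq_bigr => i _; rewrite ltn_ord.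
Qed.

Lemma size_alt_cycle h g x : size (alt_cycle h g x) = (2 * h).+1.
Proof. exact: size_mkseq. Qed.

Lemma mem_alt_cycle h g x i : (i < 2 * h)%N -> sg i * g i \in alt_cycle h g x.
Proof.
move=> ih; apply/mapP; exists i; last by rewrite ih.
by rewrite mem_iota /=; lia.
Qed.

Lemma alt_cycle_last h g x : x \in alt_cycle h g x.
Proof.
apply/mapP; exists (2 * h)%N; last by rewrite ltnn.
by rewrite mem_iota /=; lia.
Qed.

(** * Base cycles with one or two steps *)

Lemma coprimezN1 (d : nat) : coprimez (-1) d.
Proof. by rewrite coprimezE coprime1n. Qed.

Lemma coprimez1 (d : nat) : coprimez 1 d.
Proof. by rewrite coprimezE coprime1n. Qed.

Lemma unit_base N (a : int) : (0 < N)%N -> coprimez a N -> base_cycle N [:: a].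
Proof.
move=> N0 ca; split=> //=; first by case=> [|i] [|j] //; lia.
exists a; last by rewrite divn1.
by rewrite /psum big_ord1 mul1r.
Qed.

(** [N - 1] is odd and coprime to its successor [N]. This base cycle takes the largest odd
    difference when it is left without a partner. *)
Lemma unit_base_half N : (0 < N)%N -> ~~ odd N -> base_cycle (2 * N) [:: (N - 1)%N%:Z].
Proof.
move=> N0 eN; apply: unit_base; first by rewrite muln_gt0.
rewrite coprimezE /= coprimeMr coprimen2; apply/andP; split; first by lia.
by rewrite coprime_sym; have := coprimenS N.-1; rewrite prednK // subn1 coprime_sym.
Qed.

Lemma pair_base N (a b u : int) : ~~ odd N -> ~~ (2 %| a)%Z ->
  a + b = 2 * u -> coprimez u N./2 -> base_cycle N [:: a; b].
Proof.
move=> eN oa ab cu; split=> //=; first by rewrite dvdn2.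
  move=> [|[|i]] [|[|j]] //=; try lia.
  by rewrite /psum big_ord0 big_ord1 subr0.
exists u; last by rewrite divn2.
by rewrite /psum big_ord_recr big_ord1 /= ab.
Qed.

(** With opposite signs the total is [2 * d] whatever [a] is, so the unit condition bears on [d]
    alone. *)
Definition odd_pair (a d : nat) : seq int := [:: - a%:Z; (a + 2 * d)%N%:Z].

Lemma odd_pair_base N a d : ~~ odd N -> odd a -> coprime d N./2 ->
  base_cycle N (odd_pair a d).
Proof.
by move=> eN oa cd; apply: (@pair_base _ _ _ d) => //; lia.
Qed.

(** For odd [a] this uses up the [2 * l] consecutive odd numbers from [a] on. *)
Definition run (a l : nat) : seq (seq int) :=
  [seq odd_pair (a + 4 * i) 1 | i <- iota 0 l].

Definition valid (N : nat) (Bs : seq (seq int)) : Prop :=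
  forall s, s \in Bs -> base_cycle N s.

(** Equality up to sign is asked in [int] rather than mod [N], which leaves it to linear arithmetic.
    Only [multiples_cycle] is treated mod [N]. *)
Definition covers (Bs : seq (seq int)) (x : nat) : Prop :=
  exists2 d, d \in flatten Bs & `|d|%N = x.

Lemma valid_cat N Bs Bs' : valid N Bs -> valid N Bs' -> valid N (Bs ++ Bs').
Proof. by move=> H H' s; rewrite mem_cat => /orP[/H|/H']. Qed.

Lemma valid1 N s : base_cycle N s -> valid N [:: s].
Proof. by move=> H t; rewrite inE => /eqP->. Qed.

Lemma valid_flatten N (I : eqType) (F : I -> seq (seq int)) r :
  (forall i, i \in r -> valid N (F i)) -> valid N (flatten (map F r)).
Proof. by move=> H s /flatten_mapP[i /H]; apply. Qed.

Lemma covers_catl Bs Bs' x : covers Bs x -> covers (Bs ++ Bs') x.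
Proof. by case=> d dB <-; exists d; rewrite // flatten_cat mem_cat dB. Qed.

Lemma covers_catr Bs Bs' x : covers Bs' x -> covers (Bs ++ Bs') x.
Proof. by case=> d dB <-; exists d; rewrite // flatten_cat mem_cat dB orbT. Qed.

Lemma covers_mem (Bs : seq (seq int)) (s : seq int) (d : int) x : s \in Bs -> d \in s -> `|d|%N = x -> covers Bs x.
Proof. by move=> sB ds <-; exists d => //; apply/flattenP; exists s. Qed.

Lemma covers_flatten (I : eqType) (F : I -> seq (seq int)) r i x :
  i \in r -> covers (F i) x -> covers (flatten (map F r)) x.
Proof.
move=> ir [d /flattenP[s sF ds] <-]; apply: (@covers_mem _ s d) => //.
by apply/flatten_mapP; exists i.
Qed.

Lemma valid_run N a l : ~~ odd N -> odd a -> valid N (run a l).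
Proof.
move=> eN oa s /mapP[i _ ->]; apply: odd_pair_base => //; last exact: coprime1n.
by rewrite oddD oddM oa.
Qed.

Lemma covers_run a l x : odd a -> odd x -> (a <= x < a + 4 * l)%N -> covers (run a l) x.
Proof.
move=> oa ox xl; pose i := ((x - a) %/ 4)%N.
have iE : x = (a + 4 * i)%N \/ x = (a + 4 * i + 2)%N by rewrite /i; lia.
have il : (i < l)%N by lia.
have mr : odd_pair (a + 4 * i) 1 \in run a l by apply/mapP; exists i; rewrite ?mem_iota.
case: iE => ->.
  by apply: (covers_mem mr (mem_head _ _)); rewrite abszN.
by apply: (covers_mem mr (mem_last _ _)).
Qed.

Lemma size_run a l : size (flatten (run a l)) = (2 * l)%N.
Proof.
suff H k : (size (flatten [seq odd_pair (a + 4 * i) 1 | i <- iota k l]) = 2 * l)%N.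
  exact: H.
by elim: l k => [|l IH] k //=; rewrite IH; lia.
Qed.

Lemma valid_one N : (0 < N)%N -> valid N [:: [:: 1]].
Proof. by move=> N0; apply/valid1/unit_base => //; apply: coprimez1. Qed.

Lemma covers_one : covers [:: [:: 1]] 1.
Proof. by apply: (@covers_mem _ [:: 1] 1). Qed.

Lemma size_flatten_cat (s t : seq (seq int)) :
  size (flatten (s ++ t)) = (size (flatten s) + size (flatten t))%N.
Proof. by rewrite flatten_cat size_cat. Qed.

Lemma size_flatten1 (s : seq int) : size (flatten [:: s]) = size s.
Proof. by rewrite /= cats0. Qed.

Lemma size_flatten_const (F : nat -> seq (seq int)) c r :
  (forall i, size (flatten (F i)) = c) ->
  size (flatten (flatten (map F r))) = (c * size r)%N.
Proof.
move=> Fc; elim: r => [|i r IH] /=; first by rewrite muln0.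
by rewrite flatten_cat size_cat Fc IH mulnS.
Qed.

Lemma size_flatten_map (F : nat -> seq int) c r :
  (forall i, size (F i) = c) -> size (flatten (map F r)) = (c * size r)%N.
Proof.
move=> Fc; elim: r => [|i r IH] /=; first by rewrite muln0.
by rewrite size_cat Fc IH mulnS.
Qed.

Definition has_factorization (m n : nat) : Prop :=
  exists FF : {set {set {set {set 'Z_(m * n)}}}},
    is_hamiltonian_2factorization (@multipartite_adj m n) FF /\ is_cyclic FF.

Lemma cyclic_factorization_of_covers m n Bs : (1 < m)%N -> (1 < n)%N -> ~~ odd n ->
  valid (m * n) Bs -> (2 * size (flatten Bs) = n * m.-1)%N ->
  (forall x, (0 < x)%N -> (2 * x < m * n)%N -> ~~ (m %| x)%N -> covers Bs x) ->
  has_factorization m n.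
Proof.
move=> m1 n1 en vB sB cB; apply: (cyclic_factorization_of_base m1 n1 en vB sB).
move=> x x0 xN mx; have [d dB dx] := cB x x0 xN mx; exists d => //.
have [->|->] : d = x%:Z \/ d = - x%:Z by lia.
  by rewrite subrr dvdz0.
by rewrite addNr dvdz0 orbT.
Qed.

(** Exactly the odd differences below [n] are wanted. They are paired off, with [1] on its own when
    their number [n / 2] is odd. *)
Lemma factorization_two_parts n : (1 < n)%N -> ~~ odd n -> has_factorization 2 n.
Proof.
move=> n1 en; have eN : ~~ odd (2 * n) by rewrite oddM.
have vr a l : odd a -> valid (2 * n) (run a l) by apply: valid_run.
have [r0|r2] : (n %% 4 = 0 \/ n %% 4 = 2)%N by lia.
  apply: (@cyclic_factorization_of_covers _ _ (run 1 (n %/ 4))) => //.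
  - exact: vr.
  - by rewrite size_run; lia.
  by move=> x x0 xn ox; apply: covers_run; rewrite ?dvdn2 ?negbK in ox *; lia.
apply: (@cyclic_factorization_of_covers _ _ ([:: [:: 1]] ++ run 3 (n %/ 4))) => //.
- by apply: valid_cat; [by apply: valid_one; rewrite muln_gt0 (ltnW n1) | apply: vr].
- by rewrite flatten_cat size_cat size_run /=; lia.
move=> x x0 xn ox; have [->|x1] := eqVneq x 1%N.
  exact/covers_catl/covers_one.
by apply/covers_catr/covers_run; rewrite ?dvdn2 ?negbK in ox *; lia.
Qed.

(** * Families of zigzag cycles that use up the even differences *)

Lemma blockZ (K a b : nat) : (2 * K * a + b)%N%:Z = 2 * K%:Z * a%:Z + b%:Z.
Proof. by rewrite PoszD !PoszM. Qed.

Section Doubles.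

Variables (h nu : nat) (e : nat -> nat) (q : int) (x : nat -> int).
Hypothesis h0 : (0 < h)%N.
Let M := (2 * h).+1.

(* The terms [2 M j] cancel in the alternating sum except in position [0], where
   they are replaced so as to shift the sum by [2 M (nu - 1 - 2 j)]; this makes
   the closing steps of the [nu] cycles distinct. *)
Definition double_cycle (j : nat) : seq int :=
  alt_cycle h (fun i => (2 * M * (if i == 0 then nu.-1 - j else j) + e i)%N%:Z) (x j).

Definition doubles : seq (seq int) := map double_cycle (iota 0 nu).

Lemma size_doubles : size (flatten doubles) = (M * nu)%N.
Proof.
by rewrite (@size_flatten_map _ M) ?size_iota // => i; rewrite size_mkseq.
Qed.

Lemma valid_doubles N : (M %| N)%N -> coprimez q M ->
  (forall i, (i < 2 * h)%N -> (M %| (e i)%:Z - q * i.+1%:Z)%Z) ->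
  (forall j, (j < nu)%N -> exists2 u : int,
    alt_sum h (fun i => (e i)%:Z) + 2 * M%:Z * (nu%:Z - 1 - 2 * j%:Z) + x j = M%:Z * u
    & coprimez u (N %/ M)%N) ->
  valid N doubles.
Proof.
move=> MN cq eq ex s /mapP[j]; rewrite mem_iota /= => jn ->.
have [u su cu] := ex j jn; apply: (alt_cycle_base MN cq _ _ cu) => [i ih|].
  rewrite blockZ -addrA rpredD ?eq //.
  by rewrite -mulrA mulrCA dvdz_mulr.
rewrite -su; congr (_ + _).
have jE : (nu.-1 - j)%N%:Z = nu%:Z - 1 - j%:Z by lia.
(* [D] is the contribution of the block terms [2 M] to the alternating sum, concentrated in its
   first pair. *)
pose D (i : nat) : int := if i == 0%N then 2 * M%:Z * (nu%:Z - 1 - 2 * j%:Z) else 0.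
have DE : \sum_(i < h) D i = 2 * M%:Z * (nu%:Z - 1 - 2 * j%:Z).
  rewrite (bigD1 (Ordinal h0)) // big1 => [|i]; first exact: addr0.
  by rewrite -val_eqE /D => /negPf->.
rewrite -DE /alt_sum -big_split /=; apply: eq_bigr => i _; rewrite /D muln_eq0 orFb.
rewrite !blockZ.
by case: (nat_of_ord i == 0%N); rewrite ?jE; ring.
Qed.

Lemma covers_doubles_even y :
  (forall r, (0 < r < M)%N -> exists2 i, (i < 2 * h)%N & e i = (2 * r)%N) ->
  ~~ odd y -> ~~ (M %| y)%N -> (y < 2 * M * nu)%N -> covers doubles y.
Proof.
move=> er ey My yn; pose b := (y %/ (2 * M))%N; pose r := (y./2 %% M)%N.
have yE : y = (2 * M * b + 2 * r)%N.
  have bE : b = (y./2 %/ M)%N by rewrite /b divnMA divn2.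
  rewrite -{1}(even_halfK ey) (divn_eq y./2 M) -bE -/r -mul2n.
  by rewrite mulnDr mulnA mulnAC.
have M0 : (0 < M)%N by [].
have rM : (0 < r < M)%N.
  rewrite /r ltn_pmod // andbT lt0n; apply: contra My => /eqP r0.
  by rewrite yE /r r0 muln0 addn0 -mulnA mulnCA dvdn_mulr.
have bn : (b < nu)%N by rewrite /b ltn_divLR // mulnC.
have [i ih ei] := er r rM.
(* In position [0] the blocks occur in reverse order. *)
pose j := if i == 0%N then (nu.-1 - b)%N else b.
have jn : (j < nu)%N by rewrite /j; case: ifP => _ //; move: bn; clear; lia.
apply: (@covers_mem _ (double_cycle j) (sg i * y%:Z)).
- by apply/map_f; rewrite mem_iota.
- have -> : y = (2 * M * (if i == 0 then nu.-1 - j else j) + e i)%N.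
    by rewrite {1}yE ei /j; case: eqP => // _; congr (_ * _ + _)%N; move: bn; clear; lia.
  exact: (mem_alt_cycle (fun i => (2 * M * (if i == 0 then nu.-1 - j else j) + e i)%N%:Z)).
by rewrite /sg; case: odd; lia.
Qed.

End Doubles.

(** * Numbers of parts congruent to 0 or 2 modulo 4 *)

Section TwiceOdd.

Variables h nu : nat.
Hypotheses (h0 : (0 < h)%N) (nu0 : (0 < nu)%N).
Let M := (2 * h).+1.
Let N := (4 * M * nu)%N.

(** With the alternating sum [-2 h] of the even steps the total becomes [-M]. Up to sign the values
    are [2 M t + 1], and [2 M t - 1] if [t > 0], for the [t < nu] of the parity of [nu - 1]. *)
Let closing (j : nat) : int := -1 - 2 * M%:Z * (nu%:Z - 1 - 2 * j%:Z).
Let cycles := doubles h nu (fun i => 2 * i.+1)%N closing.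
Let middle i := run (2 * M * (nu - 3 - 2 * i) + 3) (2 * h).

(** The runs fill the gaps of odd numbers left by the closing steps: below the first one if [nu] is
    even, then between [2 M t + 1] and [2 M (t + 2) - 1], then above the last. Each gap holds an
    even number of them. *)
Let Bs := cycles ++ (if odd nu then [::] else run 1 h)
  ++ flatten [seq middle i | i <- iota 0 nu.-1./2] ++ run (2 * M * nu.-1 + 3) h.

Let valid_Bs : valid N Bs.
Proof.
have eN : ~~ odd N by rewrite /N -mulnA oddM.
have oT a : odd (2 * M * a + 3) by rewrite oddD -mulnA oddM.
apply: valid_cat.
  apply: (valid_doubles (q := 2)) => //.
  - by rewrite /N mulnAC dvdn_mull.
  - by rewrite coprimezE /= coprime2n /= oddM.
  - by move=> i _; rewrite PoszM subrr dvdz0.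
  move=> j _; exists (-1); last exact: coprimezN1.
  rewrite (@alt_sum_affine _ 2 2); last by move=> i _; lia.
  by rewrite /closing /M; lia.
apply: valid_cat; first by case: ifP => // _; apply: valid_run.
apply: valid_cat; last by apply: valid_run.
by apply: valid_flatten => i _; apply: valid_run.
Qed.

Let size_Bs : size (flatten Bs) = (nu * (4 * h).+1)%N.
Proof.
rewrite !flatten_cat !size_cat size_doubles size_run.
rewrite (@size_flatten_const _ (4 * h)); last by move=> i; rewrite size_run; lia.
rewrite size_iota; case: ifP => on; rewrite /= ?size_run /M.
  have [a [-> ->]] : exists a, nu.-1./2 = a /\ nu = (2 * a).+1 by exists nu.-1./2; lia.
  by lia.
have [a [-> ->]] : exists a, nu.-1./2 = a /\ nu = (2 * a).+2 by exists nu.-1./2; lia.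
by lia.
Qed.

Let covers_closing j y : (j < nu)%N -> `|closing j|%N = y -> covers cycles y.
Proof.
move=> jn; apply: (@covers_mem _ (double_cycle h nu (fun i => 2 * i.+1)%N closing j)).
  by apply/map_f; rewrite mem_iota.
exact: alt_cycle_last.
Qed.

Let covers_Bs y : (y < 2 * M * nu)%N -> ~~ (2 * M %| y)%N -> covers Bs y.
Proof.
move=> yn My; have [oy|ey] := boolP (odd y); last first.
  apply/covers_catl/covers_doubles_even => //.
    by move=> r /andP[r0 rM]; exists r.-1; lia.
  apply: contra My => My; rewrite Gauss_dvd ?dvdn2 ?ey //.
  by rewrite coprime2n /= oddM.
pose w := (y %/ (2 * M))%N.
have wn : (w < nu)%N by rewrite /w ltn_divLR // mulnC.
have ylo : (2 * M * w <= y)%N by rewrite /w mulnC leq_divM.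
have yhi : (y < 2 * M * w + 2 * M)%N.
  by rewrite -mulnSr mulnC -ltn_divLR.
have M3 : (3 <= M)%N by rewrite /M; lia.
(* [t] is the largest index congruent to [nu - 1] mod 2 with [2 M t <= y] *)
have main t : (t < nu)%N -> odd (t + nu) -> (2 * M * t <= y)%N ->
    (t.+1 = nu \/ (y < 2 * M * t + 4 * M)%N) -> covers Bs y.
  move=> tn pt tlo thi.
  have [y1|y1] := eqVneq y (2 * M * t + 1)%N.
    apply/covers_catl/(@covers_closing (nu.-1 - t)./2); first by lia.
    have -> : closing (nu.-1 - t)./2 = -1 - 2 * M%:Z * t%:Z.
      by rewrite /closing; congr (_ - _ * _); lia.
    by rewrite y1; lia.
  have [tE|tN] := eqVneq t.+1 nu.
    do 3!apply: covers_catr; apply: covers_run => //.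
      by rewrite oddD -mulnA oddM.
    have -> : nu.-1 = t by lia.
    have : (2 * M * nu = 2 * M * t + 2 * M)%N by rewrite -tE mulnSr.
    by rewrite /M in M3 y1 yn tlo *; lia.
  have {thi}thi : (y < 2 * M * t + 4 * M)%N by lia.
  have t3 : (t + 3 <= nu)%N by lia.
  have [y2|y2] := eqVneq (y + 1)%N (2 * M * t + 4 * M)%N.
    apply/covers_catl/(@covers_closing (nu.-1 + t.+2)./2); first by lia.
    have -> : closing (nu.-1 + t.+2)./2 = -1 + 2 * M%:Z * (t%:Z + 2).
      by rewrite /closing -mulrN; congr (_ + _ * _); lia.
    by lia.
  do 2!apply: covers_catr; apply: covers_catl.
  apply: (@covers_flatten _ middle _ ((nu - 3 - t)./2)); first by rewrite mem_iota; lia.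
  rewrite /middle; have -> : (nu - 3 - 2 * (nu - 3 - t)./2 = t)%N by lia.
  apply: covers_run => //; first by rewrite oddD -mulnA oddM.
  by rewrite /M in M3 y1 y2 thi tlo *; lia.
have [pw|pw] := boolP (odd (w + nu)).
  apply: (main w) => //; right; lia.
have [w0|w0] := posnP w; last first.
  have E : (2 * M * w = 2 * M * w.-1 + 2 * M)%N by rewrite -mulnSr prednK.
  by apply: (main w.-1); rewrite ?E in ylo yhi *; lia.
have en : odd nu = false by move: pw; rewrite w0; lia.
rewrite w0 muln0 in yhi.
have [y2|y2] := eqVneq (y + 1)%N (2 * M)%N.
  apply/covers_catl/(@covers_closing nu./2); first by lia.
  have -> : closing nu./2 = -1 + 2 * M%:Z.
    by rewrite /closing -[X in _ = _ + X]mulr1 -mulrN; congr (_ + _ * _); lia.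
  by lia.
apply/covers_catr/covers_catl; rewrite en; apply: covers_run => //.
by rewrite /M in yhi y2; lia.
Qed.

Lemma factorization_twice_odd : has_factorization (2 * M) (2 * nu).
Proof.
have NE : (2 * M * (2 * nu) = N)%N by rewrite /N; lia.
apply: (@cyclic_factorization_of_covers _ _ Bs); rewrite ?NE.
- by rewrite /M; lia.
- by lia.
- by rewrite oddM.
- exact: valid_Bs.
- by rewrite size_Bs /M; lia.
by move=> y y0 yN My; apply: covers_Bs => //; move: yN; rewrite /N; lia.
Qed.

End TwiceOdd.

(** * Number of parts and part size both divisible by 4 *)

Section FourDividesBoth.

Variables kap nu : nat.
Hypotheses (kap0 : (0 < kap)%N) (nu0 : (0 < nu)%N).
Let m := (4 * kap)%N.
Let M := (2 * kap)%N.

(* A zigzag on the even residues mod [m], a step of [-1] mod [m], the opposite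
   zigzag on the odd residues, and a step of [1] mod [m]. *)
Definition two_path_cycle (j : nat) : seq int :=
  mkseq (fun i =>
    if (i < M.-1)%N then sg i * (m * j + 2 * i.+1)%N%:Z
    else if i == M.-1 then m%:Z * (nu%:Z - j%:Z) - 1
    else if (i < m.-1)%N then - sg (i - M) * (m * (2 * nu - 1 - j) + 2 * (i - M).+1)%N%:Z
    else m%:Z * (nu%:Z - j%:Z) + 1) m.

Let tpc_psum_lo j i : (i < M)%N ->
  psum (two_path_cycle j) i = (if odd i then (m * j)%N%:Z else 0) + 2 * zigzag i.
Proof.
elim: i => [_|i IH iM]; first by rewrite /psum big_ord0 /zigzag mulr0.
have im : (i < m)%N by rewrite /m; rewrite /M in iM; lia.
rewrite psumS IH ?zigzagS; last exact: ltnW.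
rewrite size_mkseq modn_small // nth_mkseq //.
have -> : (i < M.-1)%N by lia.
by rewrite /sg /=; case: (odd i) => /=; rewrite PoszD; ring.
Qed.

(** The partial sum after [M] steps: the odd starting point of the second path. *)
Let mid j : int := (m * j)%N%:Z + M%:Z + m%:Z * (nu%:Z - j%:Z) - 1.

Let tpc_psum_hi j i : (i < M)%N ->
  psum (two_path_cycle j) (M + i)%N =
  mid j - ((if odd i then (m * (2 * nu - 1 - j))%N%:Z else 0) + 2 * zigzag i).
Proof.
elim: i => [_|i IH iM].
  rewrite addn0 -(prednK (_ : 0 < M)%N); last by rewrite /M; lia.
  rewrite psumS tpc_psum_lo; last by rewrite /M; lia.
  rewrite size_mkseq modn_small; last by rewrite /m /M; lia.
  rewrite nth_mkseq; last by rewrite /m /M; lia.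
  rewrite ltnn eqxx /mid /zigzag.
  have -> : odd M.-1 by rewrite /M; lia.
  have -> : M.-1.+1./2 = kap by rewrite /M; lia.
  have -> : M%:Z = 2 * kap%:Z by rewrite /M PoszM.
  by rewrite /=; ring.
have im : (M + i < m)%N by rewrite /m; rewrite /M in iM *; lia.
rewrite addnS psumS IH ?zigzagS; last exact: ltnW.
rewrite size_mkseq modn_small // nth_mkseq //.
have -> : (M + i < M.-1)%N = false by lia.
have -> : (M + i == M.-1) = false by lia.
have -> : (M + i < m.-1)%N by rewrite /m; rewrite /M in iM *; lia.
have -> : (M + i - M = i)%N by lia.
by rewrite /sg /=; case: (odd i) => /=; rewrite PoszD; ring.
Qed.

Let tpc_base j : (j < nu)%N -> base_cycle (m * (4 * nu)) (two_path_cycle j).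
Proof.
move=> jn; have sz : size (two_path_cycle j) = m by rewrite size_mkseq.
have mM : m = (2 * M)%N by rewrite /m /M; lia.
have mMZ : m%:Z = 2 * M%:Z by rewrite mM PoszM.
have M0 : (0 < M)%N by rewrite /M; lia.
have mj (a : nat) : (m %| (m * a)%N%:Z)%Z by rewrite PoszM dvdz_mulr.
have m_if (b : bool) (a : nat) : (m %| if b then (m * a)%N%:Z else 0)%Z.
  by case: b; rewrite ?dvdz0.
have zz a b : (a < b < M)%N -> ~~ (m %| 2 * (zigzag b - zigzag a))%Z.
  by move=> ab; rewrite mMZ dvdz_mul2l // zigzag_inj.
split; rewrite ?sz.
- by rewrite /m; lia.
- exact: dvdn_mulr.
- move=> a b /andP[ab bm]; have [aM|aM] := ltnP a M; last first.
    rewrite -(subnKC aM) -(subnKC (ltnW (leq_ltn_trans aM ab))) !tpc_psum_hi; try lia.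
    apply: contra (zz (a - M)%N (b - M)%N _); last by lia.
    move=> H; have := rpredB H (rpredB (m_if (odd (a - M)) (2 * nu - 1 - j)%N) (m_if (odd (b - M)) (2 * nu - 1 - j)%N)).
    by rewrite -rpredN; congr (_ %| _)%Z; ring.
  have [bM|bM] := ltnP b M.
    rewrite !tpc_psum_lo //; apply: contra (zz a b _); last by rewrite ab.
    move=> H; have := rpredB H (rpredB (m_if (odd b) j) (m_if (odd a) j)).
    by congr (_ %| _)%Z; ring.
  rewrite -(subnKC bM) tpc_psum_hi ?tpc_psum_lo //; last by lia.
  (* Partial sums in different halves differ in parity, and [m] is even. *)
  apply/negP => H; have {H} : (2 %| mid j - ((if odd (b - M) then (m * (2 * nu - 1 - j))%N%:Z else 0) + 2 * zigzag (b - M)) - ((if odd a then (m * j)%N%:Z else 0) + 2 * zigzag a))%Z.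
    by apply: dvdz_trans H; rewrite mMZ dvdz_mulr.
  have m2 : (2 %| m%:Z)%Z by rewrite mMZ dvdz_mulr.
  have := dvdz_trans m2 (m_if (odd (b - M)) (2 * nu - 1 - j)%N).
  have := dvdz_trans m2 (m_if (odd a) j).
  set A := if _ then _ else _; set B := if _ then _ else _ => A2 B2.
  rewrite /mid PoszM mMZ (_ : M%:Z = 2 * kap%:Z) ?PoszM //.
  by move: A2 B2; clear; lia.
(* The second half uses block [2 * nu - 1 - j] so that the multiples of [m] add up to exactly
   [m]. *)
exists 1; last exact: coprimez1.
have E : m = (M + M.-1).+1 by rewrite /m /M; lia.
rewrite {1}E psumS tpc_psum_hi; last by lia.
rewrite sz modn_small; last by rewrite E.
rewrite nth_mkseq; last by rewrite E.
have -> : (M + M.-1 < M.-1)%N = false by lia.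
have -> : (M + M.-1 == M.-1) = false by lia.
have -> : (M + M.-1 < m.-1)%N = false by rewrite E; lia.
rewrite /mid /zigzag; have -> : odd M.-1 by rewrite /M; lia.
have -> : M.-1.+1./2 = kap by rewrite /M; lia.
have -> : M%:Z = 2 * kap%:Z by rewrite /M PoszM.
have -> : (m * (2 * nu - 1 - j))%N%:Z = m%:Z * (2 * nu%:Z - 1 - j%:Z).
  by rewrite PoszM; congr (_ * _); lia.
by rewrite PoszM; ring.
Qed.

Let gap b := run (m * b + 3) kap.-1.

(** The linking steps are [m t - 1] and [m t + 1] for [0 < t <= nu]. Each [gap] holds the odd
    numbers strictly between [m b + 1] and [m (b + 1) - 1]. Above [m * nu + 1] an odd number of them
    remains, so the largest, [2 * m * nu - 1], stands alone, as does [1]. *)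
Let Bs := map two_path_cycle (iota 0 nu) ++ flatten [seq gap b | b <- iota 0 nu]
  ++ run (m * nu + 3) (kap * nu).-1 ++ [:: [:: 1]; [:: (2 * m * nu - 1)%N%:Z]].

Let valid_Bs : valid (m * (4 * nu)) Bs.
Proof.
have N0 : (0 < m * (4 * nu))%N by rewrite /m; nia.
have eN : ~~ odd (m * (4 * nu)) by rewrite !oddM.
have oa a : odd (m * a + 3) by rewrite oddD !oddM.
apply: valid_cat => [s /mapP[j]|].
  by rewrite mem_iota => /= jn ->; apply: tpc_base.
apply: valid_cat; first by apply: valid_flatten => b _; apply: valid_run.
apply: valid_cat; first exact: valid_run.
apply: (@valid_cat _ [:: [:: 1]]); first exact: valid_one.
have -> : (m * (4 * nu) = 2 * (2 * m * nu))%N by lia.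
by apply/valid1/unit_base_half; rewrite ?oddM // /m !muln_gt0 kap0.
Qed.

Let size_Bs : size (flatten Bs) = (nu * (2 * (m.-1)))%N.
Proof.
rewrite !flatten_cat !size_cat size_run (@size_flatten_map _ m); last by move=> j; rewrite size_mkseq.
rewrite (@size_flatten_const _ (2 * kap.-1)); last by move=> b; rewrite size_run.
rewrite !size_iota /m /=; have : (0 < kap * nu)%N by rewrite muln_gt0 kap0.
by nia.
Qed.

Let covers_two_path j d y : (j < nu)%N -> d \in two_path_cycle j -> `|d|%N = y ->
  covers (map two_path_cycle (iota 0 nu)) y.
Proof. by move=> jn; apply: covers_mem; apply/map_f; rewrite mem_iota. Qed.

Let covers_Bs y : (0 < y < 2 * m * nu)%N -> ~~ (m %| y)%N -> covers Bs y.
Proof.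
move=> /andP[y0 yn] my; pose b := (y %/ m)%N; pose r := (y %% m)%N.
have yE : y = (m * b + r)%N by rewrite {1}(divn_eq y m) mulnC.
have m0 : (0 < m)%N by rewrite /m; lia.
have rm : (r < m)%N by rewrite ltn_pmod.
have r0 : (0 < r)%N by rewrite lt0n; apply: contra my => /eqP r0; rewrite /dvdn -/r r0.
have bn : (b < 2 * nu)%N by rewrite /b ltn_divLR // mulnAC.
have em : ~~ odd m by rewrite /m oddM.
have [oy|ey] := boolP (odd y); last first.
  have er : ~~ odd r by move: ey; rewrite yE oddD oddM (negPf em).
  have r2 : (r./2.-1 < M.-1)%N by move: rm r0 er; rewrite /m /M; lia.
  have rE : (2 * r./2.-1.+1 = r)%N by lia.
  apply: covers_catl; have [bnu|bnu] := ltnP b nu.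
    apply: (covers_two_path bnu (d := sg r./2.-1 * y%:Z)); last by rewrite /sg; case: odd; lia.
    apply/mapP; exists r./2.-1; last by rewrite r2 rE -yE.
    by rewrite mem_iota; move: r2; rewrite /m /M; lia.
  apply: (@covers_two_path (2 * nu - 1 - b) (- sg r./2.-1 * y%:Z)); first by lia.
    apply/mapP; exists (M + r./2.-1)%N; first by rewrite mem_iota; move: r2; rewrite /m /M; lia.
    have -> : (M + r./2.-1 < M.-1)%N = false by lia.
    have -> : (M + r./2.-1 == M.-1) = false by lia.
    have -> : (M + r./2.-1 < m.-1)%N by move: r2; rewrite /m /M; lia.
    rewrite addKn rE; have -> : (2 * nu - 1 - (2 * nu - 1 - b) = b)%N by lia.
    by rewrite -yE.
  by rewrite /sg; case: odd; lia.
have or : odd r by move: oy; rewrite yE oddD oddM (negPf em).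
have tp1 : m.-1 \in iota 0 m by rewrite mem_iota; lia.
have M0 : (0 < M)%N by rewrite /M; lia.
have mM : m = (2 * M)%N by rewrite /m /M; lia.
have tpM : M.-1 \in iota 0 m by rewrite mem_iota; lia.
have [y1|y1] := eqVneq y 1%N.
  by do 3!apply: covers_catr; rewrite y1; apply: (covers_mem (mem_head _ _) (mem_head _ _)).
have [yN|yN] := eqVneq y (2 * m * nu - 1)%N.
  by do 3!apply: covers_catr; apply: (@covers_mem _ [:: (2 * m * nu - 1)%N%:Z] (2 * m * nu - 1)%N%:Z); rewrite ?yN ?inE ?eqxx ?orbT.
have [ylast|ylast] := leqP (m * nu + 3) y.
  do 2!apply: covers_catr; apply: covers_catl; apply: covers_run => //.
    by rewrite oddD oddM (negPf em).
  have : (m * nu = 4 * (kap * nu))%N by rewrite /m mulnA.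
  have : (0 < kap * nu)%N by rewrite muln_gt0 kap0.
  have : (2 * m * nu = 2 * (m * nu))%N by rewrite mulnA.
  move: ylast yn yN oy; move: (2 * m * nu)%N (m * nu)%N (kap * nu)%N.
  by clear; lia.
have bnu : (m * b <= m * nu)%N by move: ylast; rewrite yE; lia.
have {}bnu : (b <= nu)%N by move: bnu; rewrite leq_pmul2l.
have [r1|r1] := eqVneq r 1%N.
  have b0 : (0 < b)%N by rewrite lt0n; apply: contra y1 => /eqP b0; rewrite yE r1 b0 muln0.
  apply: covers_catl; apply: (@covers_two_path (nu - b) (m * b + 1)%N%:Z); last by rewrite yE r1.
    by lia.
  apply/mapP; exists m.-1 => //.
  have -> : (m.-1 < M.-1)%N = false by lia.
  have -> : (m.-1 == M.-1) = false by lia.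
  by rewrite ltnn PoszD PoszM; congr (_ * _ + _); lia.
have {}bnu : (b < nu)%N.
  rewrite ltn_neqAle bnu andbT; apply: contraTneq ylast => bE.
  by rewrite -leqNgt yE bE leq_add2l; lia.
have [r2|r2] := eqVneq r m.-1.
  apply: covers_catl; apply: (@covers_two_path (nu - b.+1) (m%:Z * b.+1%:Z - 1)).
  - by lia.
  - apply/mapP; exists M.-1 => //.
    rewrite ltnn eqxx; congr (_ * _ - _); lia.
  rewrite yE r2; have : (m * b.+1 = m * b + m)%N by rewrite mulnSr.
  by move: m0; clear; lia.
apply/covers_catr/covers_catl; apply: (@covers_flatten _ gap _ b); first by rewrite mem_iota.
apply: covers_run => //; first by rewrite oddD oddM (negPf em).
by move: rm r1 r2 or; rewrite yE /m; clear; lia.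
Qed.

Lemma factorization_four_four : has_factorization m (4 * nu).
Proof.
apply: (@cyclic_factorization_of_covers _ _ Bs).
- by rewrite /m; lia.
- by lia.
- by rewrite oddM.
- exact: valid_Bs.
- by rewrite size_Bs; lia.
move=> y y0 yN my; apply: covers_Bs => //; rewrite y0 /=.
by move: yN; rewrite mulnCA -mulnA; lia.
Qed.

End FourDividesBoth.

(** * Odd numbers of parts *)

(** The core uses twice these residues, a zigzag with multiplier [4]. This moves the closing steps
    from beside the even multiples of [M] to beside the odd ones, which the core must avoid. *)
Definition double_mod (h i : nat) : nat :=
  if (2 * i.+1 < (2 * h).+1)%N then (2 * i.+1)%N else (2 * i.+1 - (2 * h).+1)%N.

(** Each pair contributes [-2]. The reduction mod [2 * h + 1] sets in at position [h], which splits
    a pair exactly when [h] is odd. *)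
Lemma alt_sum_double_mod h (c : nat) : (0 < h)%N ->
  alt_sum h (fun i => (c * double_mod h i)%N%:Z) =
  c%:Z * ((if odd h then (2 * h).+1%:Z else 0) - 2 * h%:Z).
Proof.
move=> h0.
suff H t : (t <= h)%N -> \sum_(i < t) ((double_mod h (2 * i))%:Z - (double_mod h (2 * i).+1)%:Z) =
    (if odd h && (h < 2 * t)%N then (2 * h).+1%:Z else 0) - 2 * t%:Z.
  rewrite /alt_sum; under eq_bigr do rewrite !PoszM -mulrBr.
  rewrite -mulr_sumr H //; congr (_ * (_ - _)).
  have -> : (h < 2 * h)%N by lia.
  by rewrite andbT.
elim: t => [|t IH] th; first by rewrite big_ord0 muln0 ltn0 andbF.
rewrite big_ord_recr /= IH; last exact: ltnW.
rewrite /double_mod; case: (boolP (odd h)) => oh /=; last first.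
  by case: ifP; case: ifP; lia.
by do 4!case: ifP => ?; lia.
Qed.

Lemma double_mod_onto h r : (0 < r < (2 * h).+1)%N ->
  exists2 i, (i < 2 * h)%N & double_mod h i = r.
Proof.
move=> rM; exists (if odd r then (r + (2 * h).+1)./2.-1 else r./2.-1);
by rewrite /double_mod; case: (boolP (odd r)) => or //=; try case: ifP; lia.
Qed.

Lemma double_mod_congr h (c : nat) i : (i < 2 * h)%N ->
  ((2 * h).+1 %| (c * double_mod h i)%N%:Z - (2 * c)%N%:Z * i.+1%:Z)%Z.
Proof.
move=> ih; rewrite /double_mod; case: ifP => lt.
  by rewrite (_ : _ - _ = 0) ?dvdz0 //; lia.
apply/dvdzP; exists (- c%:Z).
have -> : (c * (2 * i.+1 - (2 * h).+1))%N%:Z = c%:Z * (2 * i.+1%:Z - (2 * h).+1%:Z).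
  by rewrite PoszM; congr (_ * _); lia.
by rewrite PoszM; ring.
Qed.

(** * A core shared by all constructions with an odd number of parts *)

Section Core.

Variables h nu : nat.
Hypotheses (h0 : (0 < h)%N) (nu0 : (0 < nu)%N).
Let M := (2 * h).+1.

(* Up to sign these are [M (2 t + 1) - 2] and [M (2 t - 1) + 2] for [t < nu],
   [t = nu - 1] mod 2: both ends of every second interval between consecutive odd
   multiples of [M], so that an even number of odd numbers is left in each. *)
Definition core_closing (j : nat) : int := M%:Z - 2 - 2 * M%:Z * (nu%:Z - 1 - 2 * j%:Z).
Let cycles := doubles h nu (fun i => 2 * double_mod h i)%N core_closing.
(** [core_short] fills an interval between odd multiples of [M] whose two extreme odd numbers are
    closing steps; [core_long] fills an untouched one. *)
Definition core_short i := run (M * (2 * (nu - 1 - 2 * i) - 1) + 4) h.-1.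
Definition core_long i := run (M * (2 * (nu - 2 - 2 * i) - 1) + 2) h.

(* The core uses all non-multiples of [M] in [[1, 2 M nu]] except the odd numbers
   below [M] (but [M - 2] is used when [nu] is odd) and, for odd [h], the number
   [2 M nu - 1]. *)
Definition core : seq (seq int) :=
  cycles ++ flatten [seq core_short i | i <- iota 0 nu./2]
  ++ flatten [seq core_long i | i <- iota 0 nu.-1./2]
  ++ run (M * (2 * nu - 1) + 2) h./2.

Lemma valid_core N : (M %| N)%N -> ~~ odd N -> valid N core.
Proof.
move=> MN eN; have oM : odd M by rewrite /M /= oddM.
apply: valid_cat.
  apply: (valid_doubles (q := 4)) => //.
  - by rewrite coprimezE (_ : absz _ = (2 ^ 2)%N) // coprimeXl // coprime2n.
  - exact: double_mod_congr.
  move=> j _; exists (if odd h then 1 else -1); last first.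
    by case: odd; [exact: coprimez1 | exact: coprimezN1].
  by rewrite alt_sum_double_mod // /core_closing /M; case: odd; lia.
apply: valid_cat.
  apply: valid_flatten => i; rewrite mem_iota => /= ih; apply: valid_run => //.
  by rewrite oddD oddM oM; lia.
apply: valid_cat; last first.
  by apply: valid_run => //; rewrite oddD oddM oM; lia.
apply: valid_flatten => i; rewrite mem_iota => /= ih; apply: valid_run => //.
by rewrite oddD oddM oM; lia.
Qed.

(** Of the [4 * nu * h] non-multiples of [M] up to [2 * M * nu], the [h] odd ones below [M] are left
    out, except one for odd [nu], and one at the top for odd [h]. The additive form avoids truncated
    subtraction. *)
Lemma size_core : (size (flatten core) + h + odd h = 4 * nu * h + odd nu)%N.
Proof.
rewrite !flatten_cat !size_cat size_doubles size_run.
rewrite (@size_flatten_const _ (2 * h.-1)); last by move=> i; rewrite size_run.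
rewrite (@size_flatten_const _ (2 * h)); last by move=> i; rewrite size_run.
rewrite !size_iota /M; have hE := odd_double_half h; rewrite -muln2 in hE.
have [b hb] : exists b, h = b.+1 by exists h.-1; move: h0; clear; lia.
case: (boolP (odd nu)) => on.
  have [a [-> [-> ->]]] : exists a, nu./2 = a /\ nu.-1./2 = a /\ nu = (2 * a).+1.
    by exists nu./2; move: on; clear; lia.
  by move: hE; rewrite hb /=; clear; lia.
have [a [-> [-> ->]]] : exists a, nu./2 = a.+1 /\ nu.-1./2 = a /\ nu = (2 * a).+2.
  by exists nu.-1./2; move: nu0 on; clear; lia.
by move: hE; rewrite hb /=; clear; lia.
Qed.

Let covers_closing j y : (j < nu)%N -> `|core_closing j|%N = y -> covers cycles y.
Proof.
move=> jn; apply: (@covers_mem _ (double_cycle h nu (fun i => 2 * double_mod h i)%N core_closing j)).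
  by apply/map_f; rewrite mem_iota.
exact: alt_cycle_last.
Qed.

Lemma covers_core y : (0 < y < 2 * M * nu)%N -> ~~ (M %| y)%N ->
  (odd y -> (M < y)%N \/ (y = (M - 2)%N /\ odd nu)) ->
  (odd h -> y <> (2 * M * nu - 1)%N) -> covers core y.
Proof.
move=> /andP[y0 yn] My ylo yhi; have oM : odd M by rewrite /M /= oddM.
have M3 : (3 <= M)%N by rewrite /M; move: h0; clear; lia.
have [oy|ey] := boolP (odd y); last first.
  apply/covers_catl/covers_doubles_even => // r /double_mod_onto[i ih <-].
  by exists i.
have [{}ylo|[yE on]] := ylo oy; last first.
  apply/covers_catl/(@covers_closing nu./2); first by move: nu0; clear; lia.
  have -> : core_closing nu./2 = M%:Z - 2.
    rewrite /core_closing -[RHS]subr0 -[X in _ = _ - X](mulr0 (2 * M%:Z)); congr (_ - _ * _).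
    by move: on; clear; lia.
  by rewrite yE; move: M3; clear; lia.
(* So [y] is at distance [r] above the odd multiple [M * (2 * s - 1)]. *)
pose s := ((y + M) %/ (2 * M))%N; pose r := ((y + M) %% (2 * M))%N.
have sr : (y + M = 2 * M * s + r)%N by rewrite {1}(divn_eq (y + M) (2 * M)) mulnC.
have r2M : (r < 2 * M)%N by rewrite ltn_pmod.
have er : ~~ odd r by move: sr => /(congr1 odd); rewrite oddD [in RHS]oddD !oddM oy oM /= => <-.
have r0 : (0 < r)%N.
  rewrite lt0n; apply: contra My => /eqP r0.
  have : (M %| y + M)%N by rewrite sr r0 addn0 mulnAC dvdn_mull.
  by rewrite dvdn_addl.
have s0 : (0 < s)%N by rewrite divn_gt0 // mul2n -addnn leq_add2r ltnW.
have sn : (s <= nu)%N.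
  by rewrite -ltnS /s ltn_divLR // mulSn [(nu * _)%N]mulnC; move: yn M3; clear; lia.
have start k : (k.+1 = 2 * s)%N -> (M * k + M = 2 * M * s)%N.
  by move=> kE; rewrite -mulnSr kE mulnCA mulnA.
have hE := odd_double_half h; rewrite -muln2 in hE.
have [sE|sN] := eqVneq s nu.
  do 3!apply: covers_catr; apply: covers_run => //.
    by rewrite oddD oddM oM; move: nu0; clear; lia.
  have st : (M * (2 * nu - 1) + M = 2 * M * nu)%N.
    by rewrite -sE; apply: start; move: s0; clear; lia.
  move: st sr yn yhi r0 er hE; rewrite sE /M; move: (2 * _ * nu)%N (_ * (2 * nu - 1))%N.
  case: (odd h) => /= A B st sr yn yhi r0 er hE; last by move: st sr yn r0 er hE; clear; lia.
  have {}yhi := yhi isT; move: st sr yn yhi r0 er hE; clear; lia.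
have {sN}sn : (s < nu)%N by rewrite ltn_neqAle sN.
have [osn|esn] := boolP (odd (s + nu)).
  have [r2|r2] := eqVneq r 2.
    apply/covers_catl/(@covers_closing (nu.-1 - s)./2); first by move: sn; clear; lia.
    have -> : core_closing (nu.-1 - s)./2 = M%:Z - 2 - 2 * M%:Z * s%:Z.
      by rewrite /core_closing; congr (_ - _ * _); move: osn sn; clear; lia.
    move: sr ylo; rewrite r2 -PoszM; move: (2 * M * s)%N; clear; lia.
  have [r3|r3] := eqVneq r (2 * M - 2)%N.
    apply/covers_catl/(@covers_closing (nu.-1 + s)./2); first by move: sn; clear; lia.
    have -> : core_closing (nu.-1 + s)./2 = M%:Z - 2 + 2 * M%:Z * s%:Z.
      by rewrite /core_closing -mulrN; congr (_ + _ * _); move: osn sn; clear; lia.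
    by move: sr M3; rewrite r3; clear; lia.
  apply/covers_catr/covers_catl.
  apply: (@covers_flatten _ core_short _ (nu.-1 - s)./2).
    by rewrite mem_iota; move: s0 sn osn; clear; lia.
  rewrite /core_short; have -> : (nu - 1 - 2 * (nu.-1 - s)./2 = s)%N by move: sn osn; clear; lia.
  have st : (M * (2 * s - 1) + M = 2 * M * s)%N by apply: start; move: s0; clear; lia.
  apply: covers_run => //.
    by rewrite oddD oddM oM; move: s0; clear; lia.
  by move: st sr r2 r3 r2M r0 er; rewrite /M; move: h0; clear; lia.
do 2!apply: covers_catr; apply: covers_catl.
apply: (@covers_flatten _ core_long _ (nu - 2 - s)./2).
  by rewrite mem_iota; move: s0 sn esn; clear; lia.
rewrite /core_long; have -> : (nu - 2 - 2 * (nu - 2 - s)./2 = s)%N by move: sn esn; clear; lia.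
have st : (M * (2 * s - 1) + M = 2 * M * s)%N by apply: start; move: s0; clear; lia.
apply: covers_run => //.
  by rewrite oddD oddM oM; move: s0; clear; lia.
by move: st sr r2M r0 er; rewrite /M; move: h0; clear; lia.
Qed.

End Core.

Definition initial_odds (c : nat) : seq (seq int) :=
  if odd c then [:: 1] :: run 3 c./2 else run 1 c./2.

Lemma valid_initial_odds N c : (0 < N)%N -> ~~ odd N -> valid N (initial_odds c).
Proof.
move=> N0 eN; rewrite /initial_odds; case: ifP => _; last exact: valid_run.
by apply: (@valid_cat _ [:: [:: 1]]); [apply: valid_one | apply: valid_run].
Qed.

Lemma size_initial_odds c : size (flatten (initial_odds c)) = c.
Proof.
by rewrite /initial_odds; case: ifP => oc /=; rewrite size_run; move: oc; clear; lia.
Qed.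

Lemma covers_initial_odds c y : odd y -> (y < 2 * c)%N -> covers (initial_odds c) y.
Proof.
move=> oy yc; rewrite /initial_odds; case: ifP => oc; last first.
  by apply: covers_run => //; move: oy yc oc; clear; lia.
have [->|y1] := eqVneq y 1%N.
  exact: (@covers_catl [:: [:: 1]] _ _ covers_one).
by apply: (@covers_catr [:: [:: 1]]); apply: covers_run => //; move: oy yc oc y1; clear; lia.
Qed.

(** * Odd number of parts, part size divisible by 4 *)

Section OddAndFour.

Variables h nu : nat.
Hypotheses (h0 : (0 < h)%N) (nu0 : (0 < nu)%N).
Let M := (2 * h).+1.
Let N := (2 * M * nu)%N.

Lemma factorization_odd_four : has_factorization M (4 * nu).
Proof.
have NE : (M * (4 * nu) = 2 * N)%N by rewrite /N; lia.
have eN : ~~ odd N by rewrite /N -mulnA oddM.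
have N0 : (0 < N)%N by rewrite /N !muln_gt0.
pose top := if odd h then [:: [:: (N - 1)%N%:Z]] else [::].
apply: (@cyclic_factorization_of_covers _ _ (core h nu ++ initial_odds (h - odd nu) ++ top)).
- by rewrite /M; move: h0; clear; lia.
- by move: nu0; clear; lia.
- by rewrite oddM.
- rewrite NE; apply: valid_cat.
    by apply: valid_core => //; rewrite ?oddM // -NE dvdn_mulr.
  apply: valid_cat; first by apply: valid_initial_odds; rewrite ?oddM // muln_gt0.
  rewrite /top; case: ifP => // _; apply/valid1; exact: unit_base_half.
- rewrite (size_flatten_cat (core h nu)) (size_flatten_cat _ top) size_initial_odds.
  have -> : size (flatten top) = odd h by rewrite /top; case: ifP.
  have := size_core h0 nu0; rewrite /M /=.
  have : (odd nu <= h)%N by case: odd.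
  by case: (odd nu); case: (odd h) => /=; clear; nia.
move=> y y0; rewrite NE ltn_pmul2l // => yN My.
have [/andP[oh /eqP yE]|yT] := boolP (odd h && (y == N - 1)%N).
  do 2!apply: covers_catr; rewrite /top oh yE.
  exact: (@covers_mem _ [:: (N - 1)%N%:Z] (N - 1)%N%:Z (N - 1)%N (mem_head _ _) (mem_head _ _)).
have [/andP[oy yM]|yB] := boolP (odd y && (y < 2 * (h - odd nu))%N).
  by apply/covers_catr/covers_catl/covers_initial_odds.
apply/covers_catl/covers_core => //; rewrite ?y0 //.
  move=> oy; rewrite oy /= -leqNgt in yB; have My' : y != M by apply: contraNneq My => ->.
  by move: oy yB My'; rewrite /M; case: (odd nu) => /=; clear; lia.
by move=> oh yE; rewrite oh yE eqxx in yT.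
Qed.

End OddAndFour.

(* The odd numbers from [3] on, without [2 kap + 1]. The pair around the gap has
   difference 4, which is allowed when [N / 2] is odd. *)
Definition skip_odd (kap i : nat) : nat := (3 + 2 * i + 2 * (kap.-1 <= i))%N.

Definition skip_pairs (kap : nat) : seq (seq int) :=
  [seq odd_pair (skip_odd kap (2 * i)) (1 + (2 * i < kap.-1 <= (2 * i).+1))
    | i <- iota 0 kap.-1].

Lemma valid_skip_pairs N kap : ~~ odd N -> odd N./2 -> valid N (skip_pairs kap).
Proof.
move=> eN oN s /mapP[i _ ->]; apply: odd_pair_base => //.
  by rewrite /skip_odd; case: leqP => _; clear; lia.
by case: andP => _ /=; rewrite ?coprime1n // addn1 coprime2n.
Qed.

Lemma size_skip_pairs kap : size (flatten (skip_pairs kap)) = (2 * kap.-1)%N.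
Proof. by rewrite (@size_flatten_map _ 2) // size_iota. Qed.

Lemma covers_skip_pairs kap y : odd y -> (3 <= y < 4 * kap)%N -> y != (2 * kap).+1 ->
  covers (skip_pairs kap) y.
Proof.
move=> oy y3 yk.
have [i [ik yE]] : exists i, (i < 2 * kap.-1)%N /\ y = skip_odd kap i.
  exists (if (y < (2 * kap).+1)%N then (y - 3)./2 else (y - 5)./2).
  rewrite /skip_odd; case: (ltnP y (2 * kap).+1) => yk'; case: leqP => /=;
  by move: oy y3 yk yk'; clear; lia.
have mp : odd_pair (skip_odd kap (2 * i./2)) (1 + (2 * i./2 < kap.-1 <= (2 * i./2).+1))
    \in skip_pairs kap.
  by apply/mapP; exists i./2; rewrite // mem_iota; move: ik; clear; lia.
have [oi|ei] := boolP (odd i); last first.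
  apply: (covers_mem mp (mem_head _ _)); rewrite abszN yE; congr skip_odd.
  by move: ei; clear; lia.
apply: (covers_mem mp (mem_last _ _)); rewrite yE /skip_odd.
have iE : i = (2 * i./2).+1 by move: oi; clear; lia.
rewrite [in RHS]iE; move: (i./2) => j /=.
by case: (leqP kap.-1 (2 * j)); case: (leqP kap.-1 (2 * j).+1); clear; lia.
Qed.

(** * Odd number of parts, part size congruent to 2 modulo 4 *)

Section LastBlock.

Variables h nu : nat.
Hypotheses (h0 : (0 < h)%N) (nu0 : (0 < nu)%N).
Let M := (2 * h).+1.
Let N := (M * (4 * nu + 2))%N.

Let MN : (M %| N)%N. Proof. exact: dvdn_mulr. Qed.
Let N0 : (0 < N)%N. Proof. by rewrite muln_gt0 /= addn2. Qed.
Let eN : ~~ odd N. Proof. by rewrite oddM oddD oddM andbF. Qed.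
Let N2 : N./2 = (M * (2 * nu).+1)%N.
Proof. by rewrite /N; lia. Qed.
Let oN2 : odd N./2. Proof. by rewrite N2 oddM /= !oddM. Qed.

(** One zigzag uses all differences between [2 M nu] and [N / 2]. Its alternating sum is [-h], so
    the closing step [-(h + 1)] gives total [-M]; for even [h] this is the odd number that
    [skip_pairs] omits. For even [nu], [1] remains free. *)
Definition block_even : seq (seq int) :=
  core h nu ++ skip_pairs h./2 ++ [:: alt_cycle h (fun i => (2 * M * nu + i.+1)%N%:Z) (- h.+1%:Z)].

Lemma valid_block_even : ~~ odd h -> valid N block_even.
Proof.
move=> eh; apply: valid_cat; first exact: valid_core.
apply: valid_cat; first exact: valid_skip_pairs.
apply/valid1/(@alt_cycle_base _ _ 1 (-1)) => //.
- exact: coprimez1.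
- by move=> i _; rewrite PoszD mulnAC mul1r addrK PoszM dvdz_mull.
- by rewrite (@alt_sum_affine _ (2 * M * nu).+1%:Z 1) => [|i _]; lia.
exact: coprimezN1.
Qed.

Lemma size_block_even : ~~ odd h -> ~~ odd nu ->
  (size (flatten block_even) + 1 = (2 * nu).+1 * (2 * h))%N.
Proof.
move=> eh en; rewrite (size_flatten_cat (core h nu)) (size_flatten_cat (skip_pairs _)) size_skip_pairs size_flatten1 size_alt_cycle.
have := size_core h0 nu0; rewrite (negPf eh) (negPf en).
by move: h0 eh; clear; nia.
Qed.

Let last_block y : (y < N./2)%N -> ~~ (M %| y)%N -> (2 * M * nu <= y)%N ->
  exists r, (0 < r < M)%N /\ y = (2 * M * nu + r)%N.
Proof.
move=> yN My yl; exists (y - 2 * M * nu)%N; rewrite subnKC //; split=> //.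
apply/andP; split; last by move: yN yl; rewrite N2 /M; clear; nia.
rewrite subn_gt0 ltn_neqAle yl andbT; apply: contraNneq My => <-.
by rewrite mulnAC dvdn_mull.
Qed.

Lemma covers_block_even y : ~~ odd h -> ~~ odd nu -> (1 < y < N./2)%N -> ~~ (M %| y)%N ->
  covers block_even y.
Proof.
move=> eh en /andP[y1 yN] My; have [yl|yl] := leqP (2 * M * nu) y.
  do 2!apply: covers_catr; have [r [/andP[r0 rM] yE]] := last_block yN My yl.
  have rh : (r.-1 < 2 * h)%N by rewrite /M in rM; lia.
  apply: (covers_mem (mem_head _ _) (mem_alt_cycle (fun i => (2 * M * nu + i.+1)%N%:Z) _ rh)).
  by rewrite prednK // -yE /sg; case: odd; lia.
have [/andP[oy yM]|yM] := boolP (odd y && (y < M)%N); last first.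
  apply/covers_catl/covers_core => //; first by rewrite yl ltnW.
    move=> oy; left; move: yM; rewrite oy -leqNgt leq_eqVlt => /orP[/eqP yM|//].
    by rewrite -yM dvdnn in My.
  by rewrite (negPf eh).
have [yh|yh] := eqVneq y h.+1.
  do 2!apply: covers_catr; rewrite yh.
  apply: (covers_mem (mem_head _ _) (alt_cycle_last h _ _)); lia.
apply/covers_catr/covers_catl/covers_skip_pairs => //; move: oy yM yh y1 eh; rewrite /M; clear; lia.
Qed.

Lemma factorization_one_two_even : ~~ odd h -> ~~ odd nu -> has_factorization M (4 * nu + 2).
Proof.
move=> eh en; apply: (@cyclic_factorization_of_covers _ _ (block_even ++ [:: [:: 1]])).
- by rewrite /M; move: h0; clear; lia.
- by rewrite addn2.
- by rewrite oddD oddM.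
- by apply: valid_cat; [exact: valid_block_even | exact: valid_one].
- have := size_block_even eh en; rewrite flatten_cat size_cat /M /=; lia.
move=> y y0 yN My; have [->|y1] := eqVneq y 1%N; first exact/covers_catr/covers_one.
apply/covers_catl/covers_block_even => //.
by move: y0 y1 yN; rewrite -/N; lia.
Qed.

Lemma factorization_one_two_odd : ~~ odd h -> odd nu -> has_factorization M (4 * nu + 2).
Proof.
(* For odd [nu] the core already uses [M - 2]. Multiplier [2] makes the closing step [-1], so that
   the even number of odd values from [3] to [M - 4] is left for pairs. *)
move=> eh on; pose mixed := alt_cycle h (fun i => (2 * M * nu + 1 * double_mod h i)%N%:Z) (-1).
apply: (@cyclic_factorization_of_covers _ _ (core h nu ++ run 3 h./2.-1 ++ [:: mixed])).
- by rewrite /M; move: h0; clear; lia.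
- by rewrite addn2.
- by rewrite oddD oddM.
- apply: valid_cat; first exact: valid_core.
  apply: valid_cat; first exact: valid_run.
  apply/valid1/(@alt_cycle_base _ _ 2 (-1)) => //.
  + by rewrite coprimezE /= coprime2n /= oddM.
  + move=> i ih; rewrite PoszD -addrA rpredD //; first by rewrite mulnAC PoszM dvdz_mull.
    exact: (@double_mod_congr h 1).
  + rewrite (@alt_sum_shift _ (2 * M * nu)%N%:Z (fun i => (1 * double_mod h i)%N%:Z)) //.
    by rewrite alt_sum_double_mod // (negPf eh); lia.
  exact: coprimezN1.
- rewrite (size_flatten_cat (core h nu)) (size_flatten_cat (run _ _)) size_run size_flatten1 size_alt_cycle.
  have := size_core h0 nu0; rewrite (negPf eh) on /M.
  by move: h0 eh; clear; nia.
move=> y y0 yN My; have {}yN : (y < N./2)%N by move: yN; rewrite -/N; lia.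
have [yl|yl] := leqP (2 * M * nu) y.
  do 2!apply: covers_catr; have [r [rM yE]] := last_block yN My yl.
  have [i ih iE] := double_mod_onto rM.
  apply: (covers_mem (mem_head _ _) (mem_alt_cycle (fun i => (2 * M * nu + 1 * double_mod h i)%N%:Z) _ ih)).
  by rewrite iE mul1n -yE /sg; case: odd; lia.
have [->|y1] := eqVneq y 1%N.
  by do 2!apply: covers_catr; apply: (covers_mem (mem_head _ _) (alt_cycle_last h _ _)).
have [/andP[oy yM]|yM] := boolP (odd y && (y < M - 2)%N); last first.
  apply/covers_catl/covers_core => //; first by rewrite yl y0.
    move=> oy; move: yM; rewrite oy -leqNgt => yM; have My' : y != M by apply: contraNneq My => ->.
    by move: yM My' oy; rewrite on /M; clear; lia.
  by rewrite (negPf eh).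
apply/covers_catr/covers_catl/covers_run => //; move: oy yM y1 eh; rewrite /M; clear; lia.
Qed.

End LastBlock.

(** * Two vertices per part *)

Section MultiplesCycle.

Variables a nu t : nat.
Hypotheses (a0 : (0 < a)%N) (oa : odd a).
Let b := (2 * nu).+1.
Hypothesis ta1 : (b %| (t * a)%N%:Z - 1)%Z.
(** Thus [q * a] is [2] mod [b], and adding the odd [b] makes [q] odd, hence a unit mod [2 * b]. *)
Let q := (2 * t + b)%N.

Definition multiples_cycle (x : int) : seq int :=
  alt_cycle nu (fun i => (q * a * i.+1)%N%:Z) x.

Let cop_ta : coprimez (t * a)%N b.
Proof.
have [w wE] := dvdzP ta1; apply/coprimezP; exists (1, - w) => /=.
by rewrite mul1r mulNr -wE; ring.
Qed.

Let cop_tb : coprime t b.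
Proof. by move: cop_ta; rewrite PoszM coprimezMl => /andP[]. Qed.

Let cop_qb : coprime q b.
Proof. by rewrite /q -coprime_modl modnDr coprime_modl coprimeMl cop_tb coprime2n /= oddM. Qed.

(** Mod [b] both [x] and [q * a * nu] are [-1], so [b] divides the total. The total is [-1] mod [a]
    and odd, hence prime to [2 * a]. *)
Lemma multiples_cycle_base (x : int) : (b %| x + 1)%Z -> (a %| x + 1)%Z ->
  ~~ (2 %| x - (q * a * nu)%N%:Z)%Z -> base_cycle (a * b * 2) (multiples_cycle x).
Proof.
move=> bx ax ox.
have sumE : alt_sum nu (fun i => (q * a * i.+1)%N%:Z) + x = x - (q * a * nu)%N%:Z.
  rewrite (@alt_sum_affine _ (q * a)%N%:Z (q * a)%N%:Z); first by rewrite [(q * a * nu)%N%:Z]PoszM; ring.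
  by move=> i _; rewrite PoszM; lia.
have [u uE] : exists u, x - (q * a * nu)%N%:Z = b%:Z * u.
  have : (b %| x - (q * a * nu)%N%:Z)%Z.
    have -> : x - (q * a * nu)%N%:Z = (x + 1) + ((t * a)%N%:Z - 1) - b%:Z * (t * a + a * nu)%N%:Z.
      by rewrite /q /b; lia.
    by rewrite rpredB ?dvdz_mulr // rpredD.
  by case/dvdzP=> u ->; exists u; rewrite mulrC.
apply: (alt_cycle_base (q := (q * a)%N) (u := u)).
- by rewrite -/b mulnAC dvdn_mull.
- rewrite PoszM coprimezMl; apply/andP; split; first exact: cop_qb.
  by move: cop_ta; rewrite PoszM coprimezMl => /andP[].
- by move=> i _; rewrite PoszM subrr dvdz0.
- by rewrite sumE.
have -> : (a * b * 2 %/ (2 * nu).+1 = a * 2)%N by rewrite -/b mulnAC mulnK.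
have : coprimez (b%:Z * u) (a * 2)%N.
  rewrite -uE [(a * 2)%N%:Z]PoszM coprimezMr; apply/andP; split.
    have [w wE] := dvdzP ax; apply/coprimezP; exists (-1, w - (q * nu)%N%:Z) => /=.
    by rewrite mulrBl -wE mulnAC PoszM; ring.
  by rewrite coprimez_sym coprimezE /= coprime2n; move: ox; clear; lia.
by rewrite coprimezMl => /andP[].
Qed.

Lemma multiples_cycle_cover (x : int) y : (a %| y)%N -> (0 < y < a * b)%N ->
  exists2 d : int, d \in multiples_cycle x &
    ((a * b * 2)%N %| d - y%:Z)%Z || ((a * b * 2)%N %| d + y%:Z)%Z.
Proof.
case/dvdnP=> r ->; rewrite mulnC muln_gt0 a0 ltn_pmul2l //= => /andP[r0 rb].
have b2 : (0 < 2 * b)%N by [].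
have cq : coprime (2 * b) q.
  rewrite coprimeMl coprime2n [coprime b q]coprime_sym cop_qb andbT.
  by rewrite /q /b; clear; lia.
have [s _] := @Bezoutl (2 * b) q b2; rewrite (eqP cq) => sE.
(* [q * i] is [-r] mod [2 * b]. As [b] does not divide [r], [i] is neither [0] nor [b], and one of
   [i] and [2 * b - i] lies strictly between [0] and [b]. *)
pose i := ((s * r) %% (2 * b))%N.
have i2b : (i < 2 * b)%N by rewrite ltn_mod.
have iE : (2 * b %| q * i + r)%N.
  have : (2 * b %| q * (s * r) + r)%N.
    have -> : (q * (s * r) + r = r * (1 + s * q))%N by lia.
    exact: dvdn_mull.
  rewrite {1}(divn_eq (s * r) (2 * b)) -/i mulnDr -addnA dvdn_addr //.
  by rewrite mulnA dvdn_mull.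
have nb : (b %| r)%N -> False by move/(dvdn_leq r0); rewrite leqNgt rb.
have bdvd : (b %| q * i + r)%N by apply: dvdn_trans iE; apply: dvdn_mull.
have i0 : (0 < i)%N.
  rewrite lt0n; apply/eqP => i0; move: bdvd; rewrite i0 muln0 add0n; exact: nb.
have ib : i != b.
  by apply/eqP => ib; move: bdvd; rewrite ib dvdn_addr ?dvdn_mull //; apply: nb.
have dvd (z : int) : ((2 * b)%N %| z)%Z -> ((a * b * 2)%N %| a%:Z * z)%Z.
  by move=> H; rewrite -mulnA [(b * 2)%N]mulnC PoszM dvdz_mul.
have mem k : (0 < k < b)%N -> sg k.-1 * (q * a * k)%N%:Z \in multiples_cycle x.
  move=> /andP[k0 kb]; have lt : (k.-1 < 2 * nu)%N by move: k0 kb; rewrite /b; clear; lia.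
  by have := mem_alt_cycle (fun i => (q * a * i.+1)%N%:Z) x lt; rewrite prednK.
have [lt|gt|//] := ltngtP i b; last by move=> E; rewrite E eqxx in ib.
  exists (sg i.-1 * (q * a * i)%N%:Z); first by apply: mem; rewrite i0.
  have H : ((a * b * 2)%N %| (q * a * i)%N%:Z + (a * r)%N%:Z)%Z.
    rewrite (_ : _ + _ = a%:Z * (q * i + r)%N%:Z); first exact: dvd.
    by lia.
  rewrite /sg; case: odd; rewrite ?mul1r ?H ?orbT //.
  by rewrite mulN1r -opprD rpredN H.
exists (sg (2 * b - i).-1 * (q * a * (2 * b - i))%N%:Z).
  by apply: mem; move: gt i2b; clear; lia.
have H : ((a * b * 2)%N %| (q * a * (2 * b - i))%N%:Z - (a * r)%N%:Z)%Z.
  have -> : (q * a * (2 * b - i))%N%:Z - (a * r)%N%:Z =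
      a%:Z * (q%:Z * (2 * b)%N%:Z - (q * i + r)%N%:Z).
    have -> : (q * a * (2 * b - i))%N%:Z = (q * a)%N%:Z * ((2 * b)%N%:Z - i%:Z).
      by rewrite PoszM; congr (_ * _); move: i2b; clear; lia.
    by move: (2 * b)%N => B; clear; nia.
  by apply: dvd; rewrite rpredB // dvdz_mull.
rewrite /sg; case: odd; rewrite ?mul1r ?H // mulN1r.
by rewrite [X in _ || (_ %| X)%Z]addrC -[X in _ || (_ %| X)%Z]opprB rpredN H orbT.
Qed.

End MultiplesCycle.

Lemma inverse_mod (a b : nat) : (0 < b)%N -> coprime a b ->
  exists t : nat, (b %| (t * a)%N%:Z - 1)%Z.
Proof.
move=> b0 cab; have [s _] := @Bezoutl b a b0.
rewrite gcdnC (eqP cab) => sE; exists (s * b.-1)%N.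
have -> : (s * b.-1 * a)%N%:Z - 1 = (s * a)%N%:Z * b%:Z - (1 + s * a)%N%:Z.
  by move: b0; clear; case: b => // c _ /=; lia.
by rewrite rpredB ?dvdz_mull.
Qed.

Section CoprimeFactors.

Variables h nu : nat.
Hypotheses (h0 : (0 < h)%N) (nu0 : (0 < nu)%N).
Let a := (2 * h).+1.
Let b := (2 * nu).+1.
Hypothesis cab : coprime a b.

Let oa : odd a. Proof. by rewrite /a /= oddM. Qed.
Let NE : (a * (4 * nu + 2) = a * b * 2)%N. Proof. by rewrite /b; lia. Qed.
Let N2 : ((a * (4 * nu + 2))./2 = a * b)%N. Proof. by rewrite NE muln2 doubleK. Qed.

(** The multiples of [a] go to [multiples_cycle], whose closing step takes the single non-multiple
    left free by [Bs]. The parity hypothesis makes its total odd, [q * a] being odd. *)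
Lemma factorization_with_multiples (Bs : seq (seq int)) (x : int) :
  valid (a * (4 * nu + 2)) Bs ->
  (b %| x + 1)%Z -> (a %| x + 1)%Z -> ~~ (2 %| x + nu%:Z)%Z ->
  (size (flatten Bs) + b + 1 = a * b)%N ->
  (forall y, (0 < y < a * b)%N -> ~~ (a %| y)%N -> y != `|x|%N -> covers Bs y) ->
  has_factorization (a * b) 2.
Proof.
move=> vB bx ax px sB cB; have [t tE] := inverse_mod (isT : (0 < b)%N) cab.
pose s := multiples_cycle a nu t x.
apply: (@cyclic_factorization_of_base _ _ _ _ _ (Bs ++ [:: s])) => //.
- by rewrite /a /b; move: h0; clear; lia.
- rewrite -NE => r; rewrite mem_cat => /orP[/vB //|]; rewrite inE => /eqP->.
  rewrite NE; apply: multiples_cycle_base => //.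
  have oq : odd ((2 * t + b) * a) by rewrite oddM oa oddD oddM /b /= oddM.
  have [k ->] : exists k, ((2 * t + b) * a = (2 * k).+1)%N.
    by exists ((2 * t + b) * a)./2; have := odd_double_half ((2 * t + b) * a); rewrite oq -mul2n add1n => /esym.
  apply: contra px => px; have -> : x + nu%:Z = (x - ((2 * k).+1 * nu)%N%:Z) + 2 * (k * nu + nu)%N%:Z by lia.
  by rewrite rpredD // dvdz_mulr.
- rewrite size_flatten_cat size_flatten1 size_alt_cycle; move: sB; rewrite -/b; clear; lia.
move=> y y0 yN my; have {}yN : (y < a * b)%N by move: yN; rewrite [(_ * 2)%N]mulnC ltn_pmul2l.
have [ay|ay] := boolP (a %| y)%N.
  have yab : (0 < y < a * b)%N by apply/andP.
  have [d ds dy] := multiples_cycle_cover (isT : (0 < a)%N) oa tE x ay yab.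
  by exists d; rewrite // flatten_cat mem_cat /= cats0 ds orbT.
have [d dB dy] : covers (Bs ++ [:: s]) y.
  have [->|yx] := eqVneq y `|x|%N; last by apply/covers_catl/cB; rewrite ?y0.
  by apply: covers_catr; apply: (covers_mem (mem_head _ _) (alt_cycle_last _ _ _)).
exists d; first exact: dB.
have [->|->] : d = y%:Z \/ d = - y%:Z by move: dy; clear; lia.
  by rewrite subrr dvdz0.
by rewrite addNr dvdz0 orbT.
Qed.

Lemma factorization_coprime_one : ~~ odd h -> ~~ odd nu -> has_factorization (a * b) 2.
Proof.
move=> eh en; apply: (@factorization_with_multiples (block_even h nu) (-1)).
- exact: valid_block_even.
- by rewrite addNr dvdz0.
- by rewrite addNr dvdz0.
- by move: en; clear; lia.
- have := size_block_even h0 nu0 eh en; rewrite /a /b; clear; lia.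
move=> y /andP[y0 yN] ay y1; apply: covers_block_even => //.
by rewrite N2; move: y0 y1 yN; clear; lia.
Qed.

(* In the last block the even number [a b - 1] is replaced by [2 a nu - 1], of the
   same class mod [a]; it becomes the closing step of the multiples cycle. *)
Definition block_odd : seq (seq int) :=
  core h nu ++ skip_pairs h./2 ++ [:: [:: 1]] ++
  [:: alt_cycle h (fun i => (if i == (2 * h).-1 then 2 * a * nu - 1 else 2 * a * nu + i.+1)%N%:Z) h].

Let oddN2 : odd (a * (4 * nu + 2))./2.
Proof. by rewrite N2 oddM /a /b /= !oddM. Qed.

Let evenN : ~~ odd (a * (4 * nu + 2)).
Proof. by rewrite oddM oddD oddM andbF. Qed.

Let an0 : (0 < 2 * a * nu)%N. Proof. by rewrite !muln_gt0. Qed.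

Let valid_block_odd : odd h -> valid (a * (4 * nu + 2)) block_odd.
Proof.
move=> oh; have N0 : (0 < a * (4 * nu + 2))%N by rewrite muln_gt0 /= addn2.
apply: valid_cat; first by apply: valid_core => //; apply: dvdn_mulr.
apply: valid_cat; first exact: valid_skip_pairs.
apply: valid_cat; first exact: valid_one.
apply/valid1/(@alt_cycle_base _ _ 1 1).
- exact: dvdn_mulr.
- exact: coprimez1.
- have aK : ((2 * h).+1 %| (2 * a * nu)%N%:Z)%Z by rewrite mulnAC PoszM dvdz_mull.
  move=> i ih; rewrite mul1r; case: eqP => iE; last by rewrite PoszD addrK.
  rewrite (_ : _ - _ = (2 * a * nu)%N%:Z - (2 * h).+1%:Z) ?rpredB //.
  by move: an0 iE h0; clear; lia.
- have [k hk] : exists k, h = k.+1 by exists h.-1; rewrite prednK.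
  (* The replaced entry sits in the last pair with a minus sign: it raises the alternating sum from
     [-h] to [a - h], and the closing step [h] brings the total to [a]. *)
  rewrite {1}hk alt_sumS.
  rewrite (@alt_sum_affine _ (2 * a * nu).+1%:Z 1) => [|i ik]; last first.
    by case: eqP => iE; move: iE ik; rewrite hk; clear; lia.
  case: eqP => [iE|_]; first by move: iE; rewrite hk; clear; lia.
  case: eqP => [_|iE]; last by move: iE; rewrite hk; clear; lia.
  by move: an0; rewrite hk; move: (2 * a * nu)%N; clear; lia.
exact: coprimez1.
Qed.

Lemma size_block_odd : odd h -> odd nu -> (1 < h)%N ->
  (size (flatten block_odd) + b + 1 = a * b)%N.
Proof.
move=> oh on h1; rewrite (size_flatten_cat (core h nu)) (size_flatten_cat (skip_pairs _)).
rewrite (size_flatten_cat [:: [:: 1]]) !size_flatten1 size_skip_pairs size_alt_cycle /=.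
have := size_core h0 nu0; rewrite oh on.
by move: h1 oh; rewrite /a /b; clear; nia.
Qed.

Lemma covers_block_odd y : odd h -> odd nu -> (1 < h)%N -> (0 < y < a * b)%N ->
  ~~ (a %| y)%N -> y != (a * b - 1)%N -> covers block_odd y.
Proof.
move=> oh on h1 /andP[y0 yN] ay yL.
have ab : (a * b = 2 * a * nu + a)%N by rewrite /b; lia.
have last_covers i d : (i < 2 * h)%N ->
    d = (if i == (2 * h).-1 then 2 * a * nu - 1 else 2 * a * nu + i.+1)%N -> covers block_odd d.
  move=> ih ->; do 3!apply: covers_catr.
  apply: (covers_mem (mem_head _ _) (mem_alt_cycle (fun i => (if i == (2 * h).-1 then 2 * a * nu - 1 else 2 * a * nu + i.+1)%N%:Z) _ ih)).
  by rewrite /sg; case: (odd i); lia.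
have [yl|yl] := ltnP (2 * a * nu) y.
  apply: (last_covers (y - 2 * a * nu).-1); first by move: yl yN; rewrite ab /a; clear; lia.
  case: eqP => iE; last by move: yl; clear; lia.
  by move: yL; rewrite ab; move: h0 yl iE; rewrite /a; clear; lia.
have [yz|yz] := eqVneq y (2 * a * nu - 1)%N.
  by apply: (last_covers (2 * h).-1); rewrite ?eqxx //; move: h0; clear; lia.
have [->|y1] := eqVneq y 1%N.
  by do 2!apply: covers_catr; apply: covers_catl; apply: covers_one.
have {}yl : (y < 2 * a * nu)%N.
  rewrite ltn_neqAle yl andbT; apply: contraNneq ay => ->.
  by rewrite mulnAC dvdn_mull.
have [/andP[oy yM]|yM] := boolP (odd y && (y < a - 2)%N); last first.
  apply/covers_catl/covers_core => //; first by rewrite yl y0.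
    move=> oy; move: yM; rewrite oy -leqNgt => yM; have My' : y != a by apply: contraNneq ay => ->.
    by move: yM My' oy; rewrite on /a; clear; lia.
  by move=> _; apply/eqP.
have [yh|yh] := eqVneq y h.
  do 3!apply: covers_catr; rewrite yh.
  by apply: (covers_mem (mem_head _ _) (alt_cycle_last h _ _)).
apply/covers_catr/covers_catl/covers_skip_pairs => //; move: oy yM yh y1 oh; rewrite /a; clear; lia.
Qed.

(** The free difference [a * b - 1] is [-1] modulo both factors, and even while [nu] is odd, as the
    closing step requires. *)
Lemma factorization_coprime_three : odd h -> odd nu -> (1 < h)%N -> has_factorization (a * b) 2.
Proof.
move=> oh on h1; apply: (@factorization_with_multiples block_odd (a * b - 1)%N%:Z).
- exact: valid_block_odd.
- rewrite (_ : _ + 1 = (a * b)%N%:Z) ?PoszM ?dvdz_mull //; rewrite /a; lia.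
- rewrite (_ : _ + 1 = (a * b)%N%:Z) ?PoszM ?dvdz_mulr //; rewrite /a; lia.
- have : odd (a * b) by rewrite oddM oa /b /= oddM.
  by move: (a * b)%N on => k; clear; lia.
- exact: size_block_odd.
by move=> y yab ay yL; apply: covers_block_odd.
Qed.

End CoprimeFactors.

Close Scope ring_scope.

(** Split off the full power of the smallest prime divisor; the cofactor exceeds 1 because [m] is
    not a prime power. The factors agree mod 4, and if both are 3 mod 4 they cannot both equal 3, so
    they can be ordered with the first above 3. *)
Lemma coprime_factors m : 1 < m -> m %% 4 = 1 ->
  ~ (exists p a : nat, [/\ prime p, odd p, 1 <= a & m = p ^ a]) ->
  exists a b, [/\ coprime a b, m = a * b, 1 < a, 1 < b &
    (a %% 4 = 1 /\ b %% 4 = 1) \/ [/\ a %% 4 = 3, b %% 4 = 3 & 3 < a]].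
Proof.
move=> m1 m41 npp; pose p := pdiv m; have pp : prime p := pdiv_prime m1.
have m0 : 0 < m by apply: ltnW.
have om : odd m by move: m41; clear; lia.
have lp : 0 < logn p m by rewrite logn_gt0 mem_primes pp m0 pdiv_dvd.
have [a [b [cab mE a1 b1]]] : exists a b, [/\ coprime a b, m = a * b, 1 < a & 1 < b].
  exists m`_p, m`_p^'; split.
  - exact: coprime_partC.
  - by rewrite partnC.
  - by rewrite p_part (leq_trans (prime_gt1 pp)) // -{1}[p]expn1 leq_exp2l // prime_gt1.
  rewrite ltn_neqAle part_gt0 andbT eq_sym; apply/eqP => b1; apply: npp.
  exists p, (logn p m); split=> //; last by rewrite -p_part -[LHS](partnC p m0) b1 muln1.
  by apply: dvdn_odd om; apply: pdiv_dvd.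
have [oa ob] : odd a /\ odd b by apply/andP; rewrite -oddM -mE.
have ab4 : (a %% 4) * (b %% 4) %% 4 = 1 by rewrite modnMm -mE.
have [a4|a4] : a %% 4 = 1 \/ a %% 4 = 3 by move: oa; clear; lia.
  exists a, b; split=> //; left; split=> //.
  by move: ab4 ob; rewrite a4; clear; lia.
have b4 : b %% 4 = 3 by move: ab4 ob; rewrite a4; clear; lia.
have [a3|a3] := ltnP 3 a; first by exists a, b; split=> //; right.
exists b, a; split=> //; [by rewrite coprime_sym | by rewrite mulnC | right; split=> //].
rewrite ltn_neqAle; apply/andP; split; last by move: b1 b4; clear; lia.
apply/eqP => bE; have aE : a = 3 by move: a1 a3 a4; clear; lia.
by move: cab; rewrite aE -bE.
Qed.

Theorem theorem1p2 (m n : nat) (hm : 1 < m) (hn : 1 < n)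
    (hmn : ~~ odd (m * n)) :
  (exists FF : {set {set {set {set 'Z_(m * n)}}}},
      is_hamiltonian_2factorization (@multipartite_adj m n) FF
      /\ is_cyclic FF)
  <->
  [/\ ~~ odd n,
      n = 2 %[mod 4] -> m = 1 %[mod 4] \/ m = 2 %[mod 4]
    & n = 2 -> ~ (exists p a : nat,
                    [/\ prime p, odd p, 1 <= a & m = p ^ a])].
Proof.
split=> [[FF [HFF cFF]]|[en cb cc]].
  have en := parts_even hm hn hmn HFF.
  split=> //; first by apply: (even_condition hm hn hmn HFF cFF en).
  move=> n2 [p [a [pp op a0 mE]]].
  exact: (not_odd_prime_power hm hn hmn HFF cFF n2 pp op a0 mE).
rewrite -/(has_factorization m n).
(* This class of [m] admits every even [n]. Otherwise 4 divides [n] and [m] is odd or a multiple of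
   4, or [n] is 2 mod 4 and condition (b) leaves [m] congruent to 1. *)
have [m2|m2] := eqVneq (m %% 4) 2.
  have [h ->] : exists h, m = 2 * (2 * h).+1 by exists (m %/ 4); move: m2; clear; lia.
  have [nu nuE] : exists nu, n = 2 * nu by exists n./2; move: en; clear; lia.
  have nu0 : 0 < nu by move: hn; rewrite nuE; clear; lia.
  have [->|h0] := posnP h; first exact: factorization_two_parts.
  by rewrite nuE; apply: factorization_twice_odd.
have [n4|n4] : n %% 4 = 0 \/ n %% 4 = 2 by move: en; clear; lia.
  have [nu nuE] : exists nu, n = 4 * nu by exists (n %/ 4); move: n4; clear; lia.
  have nu0 : 0 < nu by move: hn; rewrite nuE; clear; lia.
  rewrite nuE; have [om|em] := boolP (odd m).
    have [h hE] : exists h, m = (2 * h).+1 by exists m./2; move: om; clear; lia.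
    by rewrite hE; apply: factorization_odd_four => //; move: hm; rewrite hE; clear; lia.
  have [kap kE] : exists kap, m = 4 * kap by exists (m %/ 4); move: m2 em; clear; lia.
  by rewrite kE; apply: factorization_four_four => //; move: hm; rewrite kE; clear; lia.
have m4 : m %% 4 = 1.
  by have [] := cb n4 => // m2'; rewrite m2' in m2.
have [k kE] : exists k, m = (2 * (2 * k)).+1 by exists (m %/ 4); move: m4; clear; lia.
have [nu nuE] : exists nu, n = 4 * nu + 2 by exists (n %/ 4); move: n4; clear; lia.
(* For [nu = 0], that is [n = 2], there is no room for a core below the last block; the core is then
   built on a proper factor of [m]. *)
have [nu0|nu0] := posnP nu; last first.
  have k0 : 0 < 2 * k by move: hm; rewrite kE; clear; lia.
  have ek : ~~ odd (2 * k) by rewrite oddM.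
  rewrite nuE kE; have [on|en'] := boolP (odd nu); first exact: factorization_one_two_odd.
  exact: factorization_one_two_even.
have n2 : n = 2 by rewrite nuE nu0.
have [a [b [cab -> a1 b1 ab4]]] := coprime_factors hm m4 (cc n2).
have [oa ob] : odd a /\ odd b by case: ab4 => -[]; clear; lia.
have [h hE] : exists h, a = (2 * h).+1 by exists a./2; move: oa; clear; lia.
have [l lE] : exists l, b = (2 * l).+1 by exists b./2; move: ob; clear; lia.
have h0 : 0 < h by move: a1; rewrite hE; clear; lia.
have l0 : 0 < l by move: b1; rewrite lE; clear; lia.
rewrite n2 hE lE; rewrite hE lE in cab ab4.
case: ab4 => [[a4 b4]|[a4 b4 a3]].
  by apply: factorization_coprime_one => //; [move: a4|move: b4]; clear; lia.
by apply: factorization_coprime_three => //; [move: a4|move: b4|move: a3]; clear; lia.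
Qed.
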